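(* Let $\sigma:\Sigma\to\Sigma$ be the left shift on $\Sigma=\{0,1\}^{\mathbb{Z}}$ and let $\tau_1:\Sigma\to\mathbb{R}^+$ be a Hölder continuous (strictly positive) roof function, i.e. there are $L\ge 1$ and $\alpha\in(0,1]$ with $|\tau_1(x)-\tau_1(y)|\le L\,d(x,y)^\alpha$ for all $x,y\in\Sigma$. Let $X_{\tau_1}$ be the suspension space with roof function $\tau_1$, equipped with the Bowen–Walters metric $\rho$, and let $\psi_t$ be the induced suspension flow on $X_{\tau_1}$. Then $\psi_t$ has local product structure.
   Context: Metric on $\Sigma$: $d(a,b)=\frac13\sum_{i\in\mathbb{Z}}\frac{|a_i-b_i|}{2^{|i|}}$. Suspension: for a continuous $\tau:\Sigma\to(0,\infty)$, $X_\tau=\{(a,t):a\in\Sigma,\ 0\le t\le\tau(a)\}/\sim$ with $(a,\tau(a))\sim(\sigma(a),0)$; the suspension flow is the vertical unit-speed translation, $(a,s)\mapsto(a,s+t)$ for $t\ge0$, $s+t\le\tau(a)$, extended to all $t\in\mathbb{R}$ through the identification. Bowen–Walters metric: let $X_1=\Sigma\times[0,1]/((x,1)\sim(\sigma(x),0))$ be the suspension with constant roof $1$ and $\phi_t$ its suspension flow. A finite chain $w_1,\dots,w_n$ in $X_1$ is admissible if for each $k$ either $w_k,w_{k+1}$ both lie in $\Sigma\times\{t\}$ for some $t\in[0,1]$, or $w_{k+1}$ lies on the $\phi$-orbit of $w_k$. If $w_k=(a_k,t)$ and $w_{k+1}=(a_{k+1},t)$ lie in a common $\Sigma\times\{t\}$,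 put $|w_kw_{k+1}|=(1-t)d(a_k,a_{k+1})+t\,d(\sigma(a_k),\sigma(a_{k+1}))$; if there is no such common $t$, put $|w_kw_{k+1}|=\min\{|t|:\phi_t(w_k)=w_{k+1}\}$. Let $\rho_0(x_1,x_2)$ be the infimum of $\sum_{k=1}^{n-1}|w_kw_{k+1}|$ over all admissible chains with $w_1=x_1$, $w_n=x_2$. On $X_\tau$ set $\rho((a,t),(b,s))=\rho_0\big((a,t/\tau(a)),(b,s/\tau(b))\big)$ for $0\le t\le\tau(a)$, $0\le s\le\tau(b)$. For a flow $\psi_t$ on a compact metric space $(X,\rho)$ and $\varepsilon>0$: $W^s_\varepsilon(x)$ is the set of $y\in X$ with $\rho(\psi_t(y),\psi_t(x))\to0$ as $t\to+\infty$ and $\rho(\psi_t(y),\psi_t(x))\le\varepsilon$ for all $t\ge0$; $W^u_\varepsilon(x)$ is the set of $y\in X$ with $\rho(\psi_t(y),\psi_t(x))\to0$ as $t\to-\infty$ and $\rho(\psi_t(y),\psi_t(x))\le\varepsilon$ for all $t\le0$. Local product structure: for every sufficiently small $\varepsilon>0$ there is $\delta>0$ such that for every $x,y\in X$ with $\rho(x,y)\le\delta$ there is a unique $\theta\in\mathbb{R}$ with $|\theta|\le\varepsilon$ such that $W^s_\varepsilon(\psi_\theta(x))\cap W^u_\varepsilon(y)$ contains exactly one point. *)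

(* Defs.v *)
From mathcomp Require Import all_boot all_order all_algebra.
From mathcomp Require Import all_classical all_reals all_analysis.
From Stdlib Require Import Relations.Relation_Operators.

Set Implicit Arguments.
Unset Strict Implicit.
Unset Printing Implicit Defensive.

Import Order.TTheory GRing.Theory Num.Theory.
Import numFieldNormedType.Exports.
Local Open Scope classical_set_scope.
Local Open Scope ring_scope.
Local Open Scope quotient_scope.

(* Bi-infinite 0-1 sequences; a notation rather than a definition, so that the
   choiceType structure of the function space is found. *)
Notation Sigma := (int -> bool).

Definition left_shift (a : Sigma) : Sigma := fun i => a (i + 1).

Section Metric.
Variable R : realType.

(* All terms are nonnegative and the sum is at most 3, so [fine] is harmless. *)
Definition dist (a b : Sigma) : R :=
  fine (\esum_(i in [set: int])
          (`|(a i)%:R - (b i)%:R| / 2 ^+ absz i)%:E)%E / 3.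

End Metric.

Section Suspension.
Variable R : realType.
Variable tau : Sigma -> R.

Definition column : Type := {p : Sigma * R | 0 <= p.2 <= tau p.1}.

Definition base (p : column) : Sigma := (val p).1.
Definition height (p : column) : R := (val p).2.

Definition glue (p q : column) : Prop :=
  [/\ height p = tau (base p), base q = left_shift (base p) & height q = 0].

Definition glued : rel column := fun p q => `[< clos_refl_sym_trans _ glue p q >].

Lemma glued_refl : reflexive glued.
Proof. by move=> p; apply/asboolP; exact: rst_refl. Qed.

Lemma glued_sym : symmetric glued.
Proof. by move=> p q; apply/asboolP/asboolP => h; exact: rst_sym. Qed.

Lemma glued_trans : transitive glued.
Proof.
by move=> q p r /asboolP pq /asboolP qr; apply/asboolP; exact: rst_trans pq qr.
Qed.

Canonical glued_equiv := EquivRel glued glued_refl glued_sym glued_trans.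

Definition suspension : Type := {eq_quot glued_equiv}.

(* [flow_rel t x y]: the unit-speed vertical motion carries x to y in time t.
   The last two rules extend the motion inside a column to all real times. *)
Inductive flow_rel : R -> suspension -> suspension -> Prop :=
| flow_rel_up (p q : column) (t : R) :
    0 <= t -> base q = base p -> height q = height p + t ->
    flow_rel t (\pi_suspension p) (\pi_suspension q)
| flow_rel_opp (t : R) (x y : suspension) :
    flow_rel t x y -> flow_rel (- t) y x
| flow_rel_add (s t : R) (x y z : suspension) :
    flow_rel s x y -> flow_rel t y z -> flow_rel (s + t) x z.

(* For a continuous positive roof there is exactly one such point, and the
   default value x of [xget] plays no role. *)
Definition flow (t : R) (x : suspension) : suspension :=
  xget x [set y | flow_rel t x y].

End Suspension.

Section BowenWalters.
Variable R : realType.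

Local Notation X1 := (suspension (fun=> 1 : R)).

(* The lengths obtained by writing w and w' at a common height t.  A pair lying
   both at height 0 and at height 1 gets the same length from either, so there
   is at most one. *)
Definition horizontal_length (w w' : X1) : set R :=
  [set l | exists p q : column (fun=> 1 : R),
    [/\ \pi_X1 p = w, \pi_X1 q = w', height q = height p &
        l = (1 - height p) * dist R (base p) (base q)
            + height p * dist R (left_shift (base p)) (left_shift (base q))]].

Definition vertical_length (w w' : X1) : set R :=
  [set `|t| | t in [set t : R | flow t w = w']].

Definition admissible_step (w w' : X1) : Prop :=
  horizontal_length w w' !=set0 \/ exists t : R, flow t w = w'.

Definition step_length (w w' : X1) : R :=
  if `[< horizontal_length w w' !=set0 >] then xget 0 (horizontal_length w w')
  else xget 0 [set m | vertical_length w w' m /\ lbound (vertical_length w w') m].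

(* The chain w_1, ..., w_n is x :: s. *)
Definition rho0 (x y : X1) : R :=
  inf [set l | exists s : seq X1,
    [/\ path (fun w w' => `[< admissible_step w w' >]) x s, last x s = y &
        l = \sum_(c <- pairmap step_length x s) c]].

Variable tau : Sigma -> R.

Lemma rescale_subproof (p : column tau) :
  0 <= (base p, height p / tau (base p)).2 <= (1 : R).
Proof.
have /andP[] := valP p; rewrite -/(height p) -/(base p) /=.
move: (height p) (tau (base p)) => t u t0 tle.
have u0 : 0 <= u by exact: le_trans tle.
rewrite divr_ge0 //=; have [->|u_neq0] := eqVneq u 0.
  by rewrite invr0 mulr0 ler01.
by rewrite ler_pdivrMr ?mul1r// lt_neqAle eq_sym u_neq0.
Qed.

Definition rescale_column (p : column tau) : column (fun=> 1 : R) :=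
  exist _ (base p, height p / tau (base p)) (rescale_subproof p).

Definition rescale (x : suspension tau) : X1 := \pi_X1 (rescale_column (repr x)).

(* Independence of the representative. *)
Lemma rescale_pi (p : column tau) : (forall a, 0 < tau a) ->
  rescale (\pi_(suspension tau) p) = \pi_X1 (rescale_column p).
Proof.
move=> tau_gt0; suff key q r : clos_refl_sym_trans _ (@glue R tau) q r ->
    \pi_X1 (rescale_column q) = \pi_X1 (rescale_column r).
  by apply: key; apply/asboolP; have /eqmodP := reprK (\pi_(suspension tau) p).
elim=> {q r} [{}p q [hp bq hq]|//|{}p q _ ->//|{}p q r _ -> _ ->//].
apply/eqmodP/asboolP; apply: rst_step; split.
- by rewrite /height /= -/(height p) hp divff// gt_eqF.
- by rewrite /base /= -/(base p) -/(base q).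
- by rewrite /height /= -/(height q) hq mul0r.
Qed.

Definition rho (x y : suspension tau) : R := rho0 (rescale x) (rescale y).

End BowenWalters.

Section LocalProductStructure.
Variables (R : realType) (X : Type) (d : X -> X -> R) (psi : R -> X -> X).

Definition stable_set (eps : R) (x : X) : set X :=
  [set y | (d (psi t y) (psi t x) @[t --> +oo%R] --> (0 : R)) /\
           forall t, 0 <= t -> d (psi t y) (psi t x) <= eps].

Definition unstable_set (eps : R) (x : X) : set X :=
  [set y | (d (psi t y) (psi t x) @[t --> -oo%R] --> (0 : R)) /\
           forall t, t <= 0 -> d (psi t y) (psi t x) <= eps].

Definition local_product_structure : Prop :=
  exists2 eps0 : R, 0 < eps0 & forall eps : R, 0 < eps <= eps0 ->
  exists2 delta : R, 0 < delta & forall x y : X, d x y <= delta ->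
  exists! theta : R, `|theta| <= eps /\
    exists! z : X, (stable_set eps (psi theta x) `&` unstable_set eps y) z.

End LocalProductStructure.

(* Main.v *)
(* Idea.  Write P(a, h) for the point reached from (a, 0) after time h; then
   P(a, h) = P(b, k) exactly when b is a shift of a and h - k is the matching
   Birkhoff sum of the roof.  A short chain in the unit suspension moves the base
   point and the height by little, so in these coordinates two points are
   rho-close exactly when they have representatives with close base sequences and
   close heights.  A point z = P(c, r) that shadows x forever in the future
   therefore has c = a to the right of 0 for some x = P(a, h), and being asymptotic
   to x forces h - r to be the sum of the differences of the roof along the
   orbits of a and c, a series that converges geometrically because the roof is
   Hölder and the orbits converge exponentially.  The past is symmetric.  Hence
   the point common to W^s(psi_theta x) and W^u(y) has as base the sequence that
   follows y to the left of 0 and x to the right; its height is determined by y,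
   and theta by comparing that height with the one prescribed by x. *)
Require Import Defs.
From mathcomp Require Import all_boot all_order all_algebra.
From mathcomp Require Import all_classical all_reals all_analysis.
From mathcomp Require Import zify ring lra.
From Stdlib Require Import Relations.Relation_Operators.

Import Order.TTheory GRing.Theory Num.Theory.
Import numFieldNormedType.Exports.
Local Open Scope classical_set_scope.
Local Open Scope ring_scope.
Local Open Scope quotient_scope.

Set Implicit Arguments.
Unset Strict Implicit.
Unset Printing Implicit Defensive.

(** * The metric on sequences *)

Definition shift (n : int) (a : Sigma) : Sigma := fun i => a (i + n).

Lemma shift0 a : shift 0 a = a.
Proof. by apply/funext => i; rewrite /shift addr0. Qed.

Lemma shiftD m n a : shift m (shift n a) = shift (m + n) a.
Proof. by apply/funext => i; rewrite /shift addrA. Qed.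

Section Distance.
Variable R : realType.
Implicit Types (a b c : Sigma) (i : int).
Local Notation dist := (dist R).

Definition dist_term a b i : R := `|(a i)%:R - (b i)%:R| / 2 ^+ absz i.

Lemma dist_term_ge0 a b i : 0 <= dist_term a b i.
Proof. by rewrite divr_ge0// exprn_ge0. Qed.

(** Nonnegative and negative indices are bounded separately by geometric series with sums 2 and
    1. *)
Let esum_dist_le3 a b : (\esum_(i in [set: int]) (dist_term a b i)%:E <= 3%:E)%E.
Proof.
apply: (@le_trans _ _ (\esum_(i in [set: int]) (1 / 2 ^+ absz i : R)%:E)%E).
  apply: le_esum => i _; rewrite lee_fin ler_pM2r ?invr_gt0 ?exprn_gt0//.
  by case: (a i) (b i) => [] []; rewrite ?subrr ?normr0 ?subr0 ?sub0r ?normrN ?normr1.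
rewrite (esumID (range Posz)) => [|i _]; last first.
  by rewrite lee_fin divr_ge0// exprn_ge0.
have -> : [set: int] `&` ~` range Posz = range Negz.
  apply/seteqP; split=> [[] n [_ h]|_ [n _ <-]].
  - by exfalso; apply: h; exists n.
  - by exists n.
  - by split=> // -[].
have half (r : R) k : 0 <= r -> (\esum_(n in [set: nat]) (r / (2 ^ (n + k.+1))%:R)%:E
    = (r / 2 ^+ k)%:E :> \bar R)%E.
  move=> r0.
  rewrite -nneseries_esumT; last first.
    by move=> n; rewrite lee_fin divr_ge0.
  by apply: cvg_lim => //; exact: cvg_geometric_eseries_half.
rewrite setTI (_ : 3%:E = 2%:E + 1%:E)%E; last by congr EFin; lra.
apply: leeD.
- rewrite esum_image; last by move=> ? ? _ _ [].
  rewrite -[2 in leRHS]divr1 -(expr0 2) -half// le_esum// => n _.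
  by rewrite lee_fin addn1 natrX exprS invfM mulrA divff.
- rewrite esum_image; last by move=> ? ? _ _ [].
  rewrite -[1 in leRHS]divr1 -(expr0 2) -half// le_esum// => n _.
  by rewrite lee_fin addn1 natrX.
Qed.

(** The sum is finite, so [fine] loses nothing and distances can be compared term by term. *)
Lemma esum_dist a b :
  (\esum_(i in [set: int]) (dist_term a b i)%:E = (3 * dist a b)%:E)%E.
Proof.
rewrite /Defs.dist mulrC divfK// fineK// ge0_fin_numE.
  by rewrite (le_lt_trans (esum_dist_le3 a b))// ltry.
by apply: esum_ge0 => i _; rewrite lee_fin dist_term_ge0.
Qed.

(* Four pairs of sequences, so that one lemma yields the triangle inequality and,
   by repeating a pair, estimates with the factors 2 and 1/2. *)
Lemma dist_comparison n a1 b1 a2 b2 a3 b3 a4 b4 :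
  (forall i, dist_term a1 b1 i + dist_term a2 b2 i
             <= dist_term a3 b3 (i + n) + dist_term a4 b4 (i + n)) ->
  dist a1 b1 + dist a2 b2 <= dist a3 b3 + dist a4 b4.
Proof.
have t0 a b i : [set: int] i -> (0 <= (dist_term a b i)%:E)%E.
  by rewrite lee_fin dist_term_ge0.
move=> h; rewrite -(ler_pM2l (ltr0n R 3)) !mulrDr -lee_fin !EFinD -!esum_dist.
rewrite -!esumD//; try by move=> i; exact: t0.
rewrite [leRHS](reindex_esum [set: int] [set: int] (fun i => i + n)); last first.
  split=> // [i j _ _ /addIr//|i _]; exists (i - n) => //; exact: subrK.
by apply: le_esum => i _; rewrite -!EFinD lee_fin.
Qed.

Lemma dist_term_refl a i : dist_term a a i = 0.
Proof. by rewrite /dist_term subrr normr0 mul0r. Qed.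

Lemma dist_refl a : dist a a = 0.
Proof.
rewrite /Defs.dist (_ : (\esum_(i in _) _)%E = 0%E) ?mul0r// esum1// => i _.
by rewrite -[X in X%:E]/(dist_term a a i) dist_term_refl.
Qed.

Lemma dist_le a b c d n :
  (forall i, dist_term a b i <= dist_term c d (i + n)) -> dist a b <= dist c d.
Proof.
move=> h; rewrite -[leLHS]addr0 -[leRHS]addr0 -{1}(dist_refl a) -(dist_refl a).
by apply: (dist_comparison (n := n)) => i; rewrite !dist_term_refl !addr0.
Qed.

Lemma dist_ge0 a b : 0 <= dist a b.
Proof.
by rewrite -(dist_refl a); apply: (dist_le (n := 0)) => i;
  rewrite dist_term_refl dist_term_ge0.
Qed.

Lemma dist_le1 a b : dist a b <= 1.
Proof.
by rewrite -(ler_pM2l (ltr0n R 3)) mulr1 -lee_fin -esum_dist esum_dist_le3.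
Qed.

Lemma dist_triangle b a c : dist a c <= dist a b + dist b c.
Proof.
rewrite -[leLHS]addr0 -(dist_refl a); apply: (dist_comparison (n := 0)) => i.
rewrite addr0 dist_term_refl addr0 -mulrDl ler_pM2r ?invr_gt0 ?exprn_gt0//.
exact: ler_distD.
Qed.

Lemma dist_sym a b : dist a b = dist b a.
Proof.
by apply/eqP; rewrite eq_le; apply/andP; split; apply: (dist_le (n := 0)) => i;
  rewrite addr0 /dist_term distrC.
Qed.

Lemma dist_term_shift n a b i : dist_term (shift n a) (shift n b) i
  = dist_term a b (i + n) * (2 ^+ absz (i + n) / 2 ^+ absz i).
Proof. by rewrite /dist_term mulrA divfK// expf_neq0. Qed.

Lemma dist_shift1 n a b : absz n = 1%N ->
  dist (shift n a) (shift n b) <= 2 * dist a b.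
Proof.
move=> n1; rewrite mulr2n mulrDl mul1r -[leLHS]addr0 -(dist_refl a).
apply: (dist_comparison (n := n)) => i.
rewrite dist_term_refl addr0 dist_term_shift -[leRHS]mulr2n -[leRHS]mulr_natr.
rewrite ler_wpM2l ?dist_term_ge0// ler_pdivrMr ?exprn_gt0// -exprS.
by rewrite ler_eXn2l ?ltr1n//; lia.
Qed.

Lemma dist_shift k n a b : (absz n <= k)%N ->
  dist (shift n a) (shift n b) <= 2 ^+ k * dist a b.
Proof.
elim: k n => [|k IH] n nk.
  by rewrite (_ : n = 0) ?shift0 ?expr0 ?mul1r//; lia.
have [nk'|nk'] := leqP (absz n) k.
  rewrite (le_trans (IH _ nk'))// ler_wpM2r ?dist_ge0//.
  by rewrite ler_eXn2l ?ltr1n.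
have [s [m [s1 -> mk]]] : exists s m : int, [/\ absz s = 1%N, n = s + m & (absz m <= k)%N].
  by case: (leP 0 n) => n0; [exists 1, (n - 1)|exists (-1), (n + 1)]; split; lia.
rewrite -!shiftD (le_trans (dist_shift1 _ _ s1))// exprS -mulrA.
by rewrite ler_wpM2l// IH.
Qed.

(** A disagreement at index 0 alone contributes 1/3. This turns metric closeness into equality of
    symbols. *)
Lemma dist_lt_third a b : dist a b < 1 / 3 -> a 0 = b 0.
Proof.
apply: contraPP => ab; apply/negP; rewrite -leNgt ler_pdivrMr// mulrC.
rewrite -lee_fin -esum_dist; apply: esum_ge; exists [set (0 : int)].
  by split=> //; exact: finite_set1.
rewrite fsbig_set1 lee_fin /dist_term expr0 divr1.
by case: (a 0) (b 0) ab => [] []//= _; rewrite ?subr0 ?sub0r ?normrN normr1.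
Qed.

Lemma dist_bracket a b c :
  (forall i, c i = a i \/ c i = b i) ->
  dist a c <= dist a b.
Proof.
move=> h; apply: (dist_le (n := 0)) => i; rewrite addr0 ler_pM2r ?invr_gt0 ?exprn_gt0//.
by case: (h i) => ->; rewrite ?subrr ?normr0.
Qed.

(* The sign [s] selects the future ([s = 1]) or the past ([s = -1]) here and below. *)
Lemma dist_shift_contract s a b : absz s = 1%N ->
  (forall i, 0 <= s * i -> a i = b i) ->
  dist (shift s a) (shift s b) <= dist a b / 2.
Proof.
move=> s1 ab; rewrite ler_pdivlMr// mulr_natr mulr2n -[leRHS]addr0.
rewrite -(dist_refl a); apply: (dist_comparison (n := s)) => i.
rewrite dist_term_refl addr0 dist_term_shift.
(* On the side of agreement the term vanishes; on the other side [|i| = |i + s| + 1], so the weight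
   is halved. *)
have [si|si] := leP 0 (s * (i + s)).
  by rewrite /dist_term (ab _ si) subrr normr0 !mul0r addr0.
rewrite -[leLHS]mulr2n -[leLHS]mulr_natr -mulrA ler_piMr ?dist_term_ge0//.
rewrite -ler_pdivlMr// ler_pdivrMr ?exprn_gt0// mul1r.
rewrite [leRHS]mulrC ler_pdivlMr// mulrC -exprS ler_eXn2l ?ltr1n//.
by nia.
Qed.

Lemma dist_shift_contractX k s a b : absz s = 1%N ->
  (forall i, 0 <= s * i -> a i = b i) ->
  dist (shift (s * k%:Z) a) (shift (s * k%:Z) b) <= dist a b / 2 ^+ k.
Proof.
move=> s1 ab; elim: k => [|k IH]; first by rewrite mulr0 !shift0 expr0 divr1.
rewrite -addn1 PoszD mulrDr mulr1 addrC -!shiftD.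
rewrite (le_trans (dist_shift_contract s1 _))//.
  by move=> i si; apply: ab; nia.
by rewrite addn1 exprSr invfM mulrA ler_pM2r// invr_gt0.
Qed.

End Distance.

(** * Orbit coordinates on a suspension *)

Lemma int_step_ind (P : int -> Prop) : P 0 ->
  (forall n, P n -> P (n + 1)) -> (forall n, P (n + 1) -> P n) ->
  forall n, P n.
Proof.
move=> P0 Pup Pdown; case; elim=> [|k IH].
- exact: P0.
- by rewrite -addn1 PoszD; exact: Pup.
- exact: Pdown.
- by apply: Pdown; rewrite (_ : Negz k.+1 + 1 = Negz k)//; lia.
Qed.

Section RoofSum.
Variables (R : realType) (tau : Sigma -> R).
Implicit Types (a : Sigma) (n k : int).

(** The Birkhoff sum of the roof along the shift; the sign for negative [n] makes the cocycle rule
    [roof_sumD] hold for all integers. *)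
Definition roof_sum a n : R :=
  match n with
  | Posz j => \sum_(i < j) tau (shift i a)
  | Negz j => - \sum_(i < j.+1) tau (shift (- (i.+1)%:Z) a)
  end.

Lemma roof_sum0 a : roof_sum a 0 = 0.
Proof. by rewrite /= big_ord0. Qed.

Lemma roof_sumS a n : roof_sum a (n + 1) = roof_sum a n + tau (shift n a).
Proof.
case: n => [j|[|j]]; first by rewrite -PoszD addn1 /= big_ord_recr.
  by rewrite (_ : Negz 0 + 1 = 0)// roof_sum0 /= big_ord1 addNr.
rewrite (_ : Negz j.+1 + 1 = Negz j) /=; last by lia.
by rewrite [in RHS]big_ord_recr /= opprD NegzE subrK.
Qed.

Lemma roof_sum1 a : roof_sum a 1 = tau a.
Proof. by rewrite -[1]add0r roof_sumS roof_sum0 add0r shift0. Qed.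

Lemma roof_sumD a n k : roof_sum a (n + k) = roof_sum a n + roof_sum (shift n a) k.
Proof.
elim/int_step_ind: k => [|k IH|k].
- by rewrite roof_sum0 !addr0.
- by rewrite addrA !roof_sumS IH shiftD addrA [k + n]addrC.
- by rewrite addrA !roof_sumS shiftD addrA [k + n]addrC => /addIr.
Qed.

Lemma roof_sumN a n : roof_sum (shift n a) (- n) = - roof_sum a n.
Proof. by apply/eqP; rewrite -addr_eq0 addrC -roof_sumD subrr roof_sum0. Qed.

End RoofSum.

Section Coordinates.
Variables (R : realType) (tau : Sigma -> R) (m : R).
Hypothesis m_gt0 : 0 < m.
Hypothesis tau_ge : forall a, m <= tau a.
Implicit Types (a b : Sigma) (n k : int) (h t : R) (p q : column tau).

Local Notation roof_sum := (roof_sum tau).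

Let tau_gt0 a : 0 < tau a. Proof. exact: lt_le_trans (tau_ge a). Qed.

Lemma roof_sum_ge a n : 0 <= n -> m * n%:~R <= roof_sum a n.
Proof.
case: n => // j _; elim: j => [|j IH]; first by rewrite mulr0 roof_sum0.
by rewrite -addn1 PoszD roof_sumS rmorphD /= mulrDr mulr1 lerD.
Qed.

Lemma roof_sum_le a n : n <= 0 -> roof_sum a n <= m * n%:~R.
Proof.
move=> n0; rewrite -[roof_sum a n]opprK -roof_sumN lerNl -mulrN -rmorphN.
by rewrite roof_sum_ge// oppr_ge0.
Qed.

(** Used to recover the index of a roof from an approximate height: between two distinct indices
    lies at least one full column. *)
Lemma roof_sum_sep a n k : n != k -> m <= `|roof_sum a n - roof_sum a k|.
Proof.
have gap i j : i < j -> m <= roof_sum a j - roof_sum a i.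
  move=> ij; rewrite -[j](subrKC i) roof_sumD [X in X - _]addrC addrK.
  have ij1 : 1 <= j - i by lia.
  apply: le_trans (@roof_sum_ge _ (j - i) _); last by lia.
  by rewrite ler_peMr ?ler1z// ltW.
rewrite neq_lt => /orP[/gap|/gap] h; last exact: le_trans (ler_norm _).
by rewrite distrC; exact: le_trans (ler_norm _).
Qed.

Lemma roof_sum_bracket a h : exists n, roof_sum a n <= h < roof_sum a (n + 1).
Proof.
(* [N] columns are taller than [|h|], so the sums at [- N] and [N] enclose [h]; the search climbs
   from [- N]. *)
pose N := (Num.trunc (`|h| / m)).+1.
have hN : `|h| < m * N%:R by rewrite mulrC -ltr_pdivrMr// truncnS_gt.
have lo : roof_sum a (- N%:Z) <= h.
  apply: le_trans (roof_sum_le _ _) _; first by lia.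
  rewrite rmorphN mulrN lerNl (le_trans _ (ltW hN))//.
  by rewrite (le_trans (ler_norm _))// normrN.
have hi : h < roof_sum a (- N%:Z + (N + N)%N%:Z).
  rewrite PoszD addrA addNr add0r (le_lt_trans (ler_norm _))// (lt_le_trans hN)//.
  by rewrite pmulrn roof_sum_ge.
elim: (N + N)%N (- N%:Z) lo hi => [|j IH] n lo hi.
  by move: lo; rewrite leNgt -{1}[n]addr0 hi.
have [hn|nh] := ltP h (roof_sum a (n + 1)); first by exists n; rewrite lo.
by apply: IH nh _; rewrite -addrA -PoszD add1n.
Qed.

Definition column_of a h (hh : 0 <= h <= tau a) : column tau :=
  exist _ (a, h) hh.

(** Each gluing moves the shift index by one. Conversely, both heights lie inside their columns,
    which leaves only the indices -1, 0 and 1, that is, equality or a single gluing. *)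
Lemma pi_eqP p q : \pi_(suspension tau) p = \pi_(suspension tau) q <->
  exists n, base q = shift n (base p) /\ height p = height q + roof_sum (base p) n.
Proof.
split=> [/eqmodP/asboolP|].
- elim=> {p q} [p q [hp bq hq]|p|p q _ [n [-> ->]]|p q r _ [n [bq hp]] _ [k [br hq]]].
  + by exists 1; rewrite roof_sum1 hq add0r.
  + by exists 0; rewrite shift0 roof_sum0 addr0.
  + by exists (- n); rewrite shiftD addNr shift0 roof_sumN addrK.
  + by exists (k + n); rewrite br bq shiftD hp hq bq addrC roof_sumD; split=> //; ring.
- wlog n0 : p q / exists2 n, 0 <= n & base q = shift n (base p) /\
      height p = height q + roof_sum (base p) n => [H|].
    move=> [n [bq hp]]; have [n0|n0] := leP 0 n; first by apply: H; exists n.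
    have H' : base p = shift (- n) (base q) /\ height q = height p + roof_sum (base q) (- n).
      by rewrite bq shiftD addNr shift0 roof_sumN hp addrK.
    by apply/esym/H; exists (- n) => //; lia.
  case: n0 => n n0 [bq hp] _.
  have /andP[p0 p1] := valP p; have /andP[q0 q1] := valP q.
  rewrite -/(height p) -/(base p) -/(height q) -/(base q) in p0 p1 q0 q1.
  have [n_eq0|n_eq1|n_ge2] : [\/ n = 0, n = 1 | 2 <= n].
    by case: n n0 {bq hp} => [[|[|j]]|j]// _; constructor.
  + congr (\pi_(_) _); apply/val_inj; move: bq hp.
    rewrite n_eq0 shift0 roof_sum0 addr0 /base /height.
    by case: (val p) (val q) => [? ?] [? ?] /= -> ->.
  + apply/eqmodP/asboolP; apply: rst_step.
    move: bq hp; rewrite n_eq1 roof_sum1 => bq hp.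
    by split=> //; lra.
  + exfalso; move: p1; rewrite hp leNgt => /negP; apply.
    rewrite -[n](subrKC 1) roof_sumD roof_sum1.
    have := @roof_sum_ge (shift 1 (base p)) (n - 1) ltac:(lia).
    have : m * 1 <= m * (n - 1)%:~R.
      by rewrite ler_pM2l// ler1z; lia.
    by move: m_gt0; lra.
Qed.

Let orbit_point_subproof a h :
  exists p, exists n, base p = shift n a /\ h = height p + roof_sum a n.
Proof.
have [n /andP[lo hi]] := roof_sum_bracket a h.
have hh : 0 <= h - roof_sum a n <= tau (shift n a).
  by move: hi; rewrite roof_sumS; lra.
by exists (column_of hh), n; rewrite /height /= subrK.
Qed.

(** Allowing every real [h] turns the flow into a translation of [h]. The chosen representative is
    immaterial by [orbit_pointE]. *)
Definition orbit_point a h : suspension tau :=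
  \pi_(suspension tau) (projT1 (cid (orbit_point_subproof a h))).

Lemma orbit_pointE p a n h : base p = shift n a -> h = height p + roof_sum a n ->
  orbit_point a h = \pi_(suspension tau) p.
Proof.
rewrite /orbit_point; case: cid => q /= [k [bq hq]] bp hp; apply/pi_eqP.
exists (n - k); rewrite bp bq shiftD subrK; split=> //.
have := roof_sumD tau a k (n - k); rewrite subrKC.
by move: hq; rewrite hp; lra.
Qed.

Lemma pi_column p : \pi_(suspension tau) p = orbit_point (base p) (height p).
Proof. by rewrite (@orbit_pointE p _ 0) ?shift0// roof_sum0 addr0. Qed.

Lemma orbit_point_canonical a h :
  exists n, 0 <= h - roof_sum a n <= tau (shift n a).
Proof.
have [n /andP[lo hi]] := roof_sum_bracket a h; exists n.
by move: hi; rewrite roof_sumS; lra.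
Qed.

Lemma orbit_point_surj x : exists a h, 0 <= h <= tau a /\ x = orbit_point a h.
Proof.
exists (base (repr x)), (height (repr x)); split; first exact: (valP (repr x)).
by rewrite -pi_column reprK.
Qed.

Lemma orbit_point_shift a h n :
  orbit_point a (h + roof_sum a n) = orbit_point (shift n a) h.
Proof.
rewrite /orbit_point; case: (cid (orbit_point_subproof (shift n a) h)) => p /= [k [bp hp]].
rewrite -(@orbit_pointE p a (k + n) (h + roof_sum a n))//; first by rewrite bp shiftD.
by rewrite hp [k + n]addrC roof_sumD; ring.
Qed.

Lemma orbit_point_eq a b h h' : orbit_point a h = orbit_point b h' ->
  exists n, b = shift n a /\ h = h' + roof_sum a n.
Proof.
rewrite /orbit_point; case: cid => p /= [n [bp hp]]; case: cid => q /= [l [bq hq]].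
move=> /pi_eqP[j [bqp hpq]]; exists (n + j - l).
have eb : b = shift (n + j - l) a.
  by rewrite addrC -shiftD [n + j]addrC -shiftD -bp -bqp bq shiftD addNr shift0.
split=> //; have := roof_sumD tau a (n + j - l) l.
by rewrite -eb subrK roof_sumD -bp hp hq hpq; lra.
Qed.

(** Shows that the motion determines its endpoint. The induction treats all coordinates of the start
    at once, since the reversal rule needs fresh coordinates for its other end. *)
Lemma flow_rel_point t x y a h :
  flow_rel t x y -> x = orbit_point a h -> y = orbit_point a (h + t).
Proof.
have move_eq b c h1 h2 t1 : orbit_point b h1 = orbit_point c h2 ->
    orbit_point b (h1 + t1) = orbit_point c (h2 + t1).
  move=> /orbit_point_eq[n [-> ->]].
  by rewrite addrAC orbit_point_shift.
move=> f; elim: f a h => {t x y} [p q t t0 bq hq|t x y _ IH|s t x y z _ IH1 _ IH2] a h.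
- by rewrite !pi_column bq hq => /move_eq.
- have [b [h1 [_ ex]]] := orbit_point_surj x.
  by rewrite (IH _ _ ex) ex => /move_eq <-; rewrite addrK.
- by move=> /IH1/IH2; rewrite addrA.
Qed.

Let flow_rel_column p : flow_rel (height p) (orbit_point (base p) 0) (\pi_(suspension tau) p).
Proof.
have /andP[p0 p1] := valP p.
have h0 : 0 <= (0 : R) <= tau (base p) by rewrite lexx ltW.
rewrite (@orbit_pointE (column_of h0) _ 0) ?shift0 ?roof_sum0 ?addr0//.
by apply: flow_rel_up => //; rewrite /height/= add0r.
Qed.

Let flow_rel_roof a n : flow_rel (roof_sum a n) (orbit_point a 0) (orbit_point a (roof_sum a n)).
Proof.
have step b : flow_rel (tau b) (orbit_point b 0) (orbit_point b (tau b)).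
  have hb : 0 <= tau b <= tau b by rewrite lexx ltW.
  rewrite [X in flow_rel _ _ X](@orbit_pointE (column_of hb) _ 0) ?shift0 ?roof_sum0 ?addr0//.
  exact: flow_rel_column (column_of hb).
have stepn k : flow_rel (tau (shift k a)) (orbit_point a (roof_sum a k))
    (orbit_point a (roof_sum a (k + 1))).
  rewrite roof_sumS addrC orbit_point_shift -[roof_sum a k]add0r orbit_point_shift.
  exact: step.
elim/int_step_ind: n => [|n IH|n].
- by have := flow_rel_add (step a) (flow_rel_opp (step a)); rewrite roof_sum0 subrr.
- by rewrite [X in flow_rel X _ _]roof_sumS; exact: flow_rel_add IH (stepn n).
- move=> IH; have := flow_rel_add IH (flow_rel_opp (stepn n)).
  by rewrite [X in flow_rel (X - _)]roof_sumS addrK.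
Qed.

(** A target exists by travelling back to [(a, 0)] and up again; it is unique by [flow_rel_point],
    so the default of [xget] is never taken. *)
Lemma flow_point t a h : flow t (orbit_point a h) = orbit_point a (h + t).
Proof.
have base_rel h' : flow_rel h' (orbit_point a 0) (orbit_point a h').
  have [n hn] := orbit_point_canonical a h'.
  rewrite (@orbit_pointE (column_of hn) _ n h') ?/height ?subrK//.
  rewrite -{1}[h'](subrKC (roof_sum a n)).
  apply: (flow_rel_add (flow_rel_roof a n)).
  have := flow_rel_column (column_of hn).
  by rewrite /base /height/= -orbit_point_shift add0r.
have rel : flow_rel t (orbit_point a h) (orbit_point a (h + t)).
  have := flow_rel_add (flow_rel_opp (base_rel h)) (base_rel (h + t)).
  by rewrite addKr.
rewrite /flow; case: xgetP => [y -> /= yr|/(_ _ rel)//].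
exact: flow_rel_point yr erefl.
Qed.

End Coordinates.

(** * Chains in the suspension of constant roof *)

(** Ensures that the minimum in the vertical length is attained, because flow times between two
    points of the unit suspension differ by integers. The induction is on an integer bound for the
    norm. *)
Lemma min_norm_coset (R : realType) (T : set R) :
  (forall t t', T t -> T t' -> exists n : int, t = t' + n%:~R) -> T !=set0 ->
  exists2 t, T t & forall t', T t' -> `|t| <= `|t'|.
Proof.
move=> cosetT [t Tt]; have := truncnS_gt `|t|; move: (Num.trunc _).+1 => k.
elim: k t Tt => [|k IH] t Tt tk; first by have := normr_ge0 t; lra.
have gap r r' : T r -> T r' -> `|r'| < `|r| -> 1 <= `|r - r'|.
  move=> Tr Tr' rr'; have [n rn] := cosetT _ _ Tr Tr'.
  have n0 : n != 0 by apply: contraTneq rr' => n0; rewrite rn n0 addr0 ltxx.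
  by rewrite rn addrAC subrr add0r -intr_norm ler1z; lia.
have smaller r : T r -> (forall t', T t' -> `|r| <= `|t'|) \/ exists2 r', T r' & `|r'| < `|r|.
  move=> Tr; have [h|/existsNP[t' /not_implyP[Tt' /negP]]] := pselect (forall t', T t' -> `|r| <= `|t'|).
    by left.
  by rewrite -ltNge => h; right; exists t'.
(* Of three elements with decreasing norms two have the same sign, so that the
   norm has dropped by at least 1. *)
have [|[t1 Tt1 tt1]] := smaller _ Tt; first by exists t.
have [|[t2 Tt2 tt2]] := smaller _ Tt1; first by exists t1.
apply: (IH t2 Tt2).
have := gap _ _ Tt Tt1 tt1; have := gap _ _ Tt1 Tt2 tt2.
have := gap _ _ Tt Tt2 (lt_trans tt2 tt1).
move: tk; rewrite -natr1; clear -tt1 tt2; move: tt1 tt2.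
case: (ger0P t); case: (ger0P t1); case: (ger0P t2);
  case: (ger0P (t - t1)); case: (ger0P (t1 - t2)); case: (ger0P (t - t2)); lra.
Qed.

Section UnitSuspension.
Variable R : realType.
Local Notation dist := (dist R).
Local Notation X1 := (suspension (fun=> 1 : R)).
Implicit Types (a b c : Sigma) (u v l : R) (w : X1).

Definition unit_point a u : X1 :=
  orbit_point (@ltr01 R) (fun _ : Sigma => lexx (1 : R)) a u.

Lemma roof_sum_cst1 a n : roof_sum (fun=> 1 : R) a n = n%:~R.
Proof.
by elim/int_step_ind: n => [|n IH|n]; rewrite ?roof_sum0// roof_sumS rmorphD/= ?IH// => /addIr.
Qed.

Lemma unit_point_surj w : exists a u, 0 <= u <= 1 /\ w = unit_point a u.
Proof. exact: orbit_point_surj. Qed.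

Lemma unit_point_eq a b u v : unit_point a u = unit_point b v ->
  exists n : int, b = shift n a /\ u = v + n%:~R.
Proof. by move=> /orbit_point_eq[n]; rewrite roof_sum_cst1; exists n. Qed.

Lemma unit_point_shift a u n : unit_point a (u + n%:~R) = unit_point (shift n a) u.
Proof. by rewrite -(roof_sum_cst1 a); exact: orbit_point_shift. Qed.

Lemma flow_unit_point t a u : flow t (unit_point a u) = unit_point a (u + t).
Proof. exact: flow_point. Qed.

Definition chord_length a b u : R :=
  (1 - u) * dist a b + u * dist (shift 1 a) (shift 1 b).

(** The coordinate [u] may be any real; the integer [n] brings it into the unit column where the
    chord is measured. *)
Lemma horizontal_lengthE a u w l : horizontal_length (unit_point a u) w l ->
  exists b n, [/\ w = unit_point b u, 0 <= u - n%:~R <= 1 &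
    l = chord_length (shift n a) (shift n b) (u - n%:~R)].
Proof.
move=> [p [q [pw qw hqp ->]]]; move: (valP p) pw qw; rewrite -/(height p) -/(base p).
rewrite !(pi_column (@ltr01 R) (fun _ : Sigma => lexx (1 : R))) => hp.
move=> /unit_point_eq[n [-> hn]] <-; exists (shift n (base q)), (- n).
rewrite hqp !shiftD addNr !shift0 rmorphN opprK -hn; split=> //.
by rewrite hn -unit_point_shift.
Qed.

Lemma horizontal_length_unit_point a b u : 0 <= u <= 1 ->
  horizontal_length (unit_point a u) (unit_point b u) !=set0.
Proof.
move=> u01; exists (chord_length a b u).
exists (@column_of _ (fun=> 1) a u u01), (@column_of _ (fun=> 1) b u u01).
by split=> //; rewrite (pi_column (@ltr01 R) (fun _ : Sigma => lexx (1 : R))).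
Qed.

(** A chord averages the distances at the shifts [n] and [n + 1], and a shift by at most 2 distorts
    distances by a factor of at most 4. *)
Lemma chord_length_ge a b n u : (absz n <= 1)%N -> 0 <= u <= 1 ->
  dist a b / 4 <= chord_length (shift n a) (shift n b) u.
Proof.
move=> n1 /andP[u0 u1]; rewrite /chord_length !shiftD.
have far k : (absz k <= 2)%N -> dist a b / 4 <= dist (shift k a) (shift k b).
  move=> k2; rewrite ler_pdivrMr// mulrC.
  have := @dist_shift R 2 (- k) (shift k a) (shift k b) ltac:(lia).
  by rewrite !shiftD addNr !shift0; lra.
have := far n ltac:(lia); have := far (1 + n) ltac:(lia).
move: (dist a b / 4) (dist _ _) (dist _ _) => x y z; nra.
Qed.

Lemma chord_length_le a b n u : (absz n <= 1)%N -> 0 <= u <= 1 ->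
  chord_length (shift n a) (shift n b) u <= 4 * dist a b.
Proof.
move=> n1 /andP[u0 u1]; rewrite /chord_length !shiftD.
have near k : (absz k <= 2)%N -> dist (shift k a) (shift k b) <= 4 * dist a b.
  by move=> k2; have := @dist_shift R 2 k a b k2; lra.
have := near n ltac:(lia); have := near (1 + n) ltac:(lia).
move: (4 * dist a b) (dist _ _) (dist _ _) => x y z; nra.
Qed.

Lemma fractional_index (n : int) u : -(1 / 2) <= u <= 3 / 2 -> 0 <= u - n%:~R <= 1 ->
  (absz n <= 1)%N.
Proof.
move=> /andP[u0 u1] /andP[n0 n1].
have : (-2)%:~R < n%:~R :> R by rewrite (_ : (-2)%:~R = -2 :> R)//; lra.
have : n%:~R < 2%:~R :> R by rewrite (_ : 2%:~R = 2 :> R)//; lra.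
by rewrite !ltr_int; lia.
Qed.

(** In suitable coordinates a step alters one entry only: the base if it is horizontal, the height
    if it is vertical. The window for [u] keeps the index [n] of a chord within
    [fractional_index]. *)
Lemma step_length_ge a u w : -(1 / 2) <= u <= 3 / 2 ->
  admissible_step (unit_point a u) w ->
  exists b v, w = unit_point b v /\
    `|v - u| + dist a b / 4 <= step_length (unit_point a u) w.
Proof.
move=> hu; rewrite /admissible_step /step_length; case: asboolP => [hor _|_ [//|[t0 ft0]]].
  case: xgetP => [l -> /horizontal_lengthE[b [n [-> hn ->]]]|]; last first.
    by case: hor => l hl /(_ l hl).
  exists b, u; split=> //; rewrite subrr normr0 add0r.
  exact: chord_length_ge (fractional_index hu hn) hn.
have [|t wt tmin] := @min_norm_coset R [set t | flow t (unit_point a u) = w] _ (ex_intro _ t0 ft0).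
  move=> t t' /= <-; rewrite !flow_unit_point => /esym/unit_point_eq[n [_ /eqP]].
  by rewrite -addrA (inj_eq (addrI u)) => /eqP ->; exists n.
case: xgetP => [l -> [[t' t'w <-] _]|/(_ `|t|)[]]; last first.
  by split; [exists t|move=> _ [t' t'w <-]; exact: tmin].
exists a, (u + t'); rewrite -flow_unit_point t'w dist_refl mul0r addr0.
by rewrite addrAC subrr add0r.
Qed.

Lemma step_length_horizontal_le a b u : 0 <= u <= 1 ->
  step_length (unit_point a u) (unit_point b u) <= 4 * dist a b.
Proof.
move=> hu; have hor := horizontal_length_unit_point a b hu.
rewrite /step_length asboolT//.
case: xgetP => [l -> /horizontal_lengthE[b' [n [/unit_point_eq[k [-> uk]] hn ->]]]|]; last first.
  by case: hor => l hl /(_ l hl).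
have k0 : k = 0 by apply/eqP; rewrite -(intr_eq0 R); apply/eqP; lra.
rewrite k0 shift0; apply: chord_length_le => //; apply: fractional_index hn.
by move: hu => /andP[]; lra.
Qed.

Lemma step_length_vertical_le a u v : 0 <= u <= 1 -> `|v - u| < 1 ->
  step_length (unit_point a u) (unit_point a v) <= `|v - u|.
Proof.
move=> hu uv; have [->|u_neq_v] := eqVneq v u.
  by rewrite subrr normr0 -(mulr0 4) -(dist_refl R a) step_length_horizontal_le.
(* Were the step also horizontal, [v - u] would be a nonzero integer, against [uv]. *)
rewrite /step_length; case: asboolP => [[l /horizontal_lengthE[b [n [+ _ _]]]]|_].
  move=> /unit_point_eq[k [_ vk]]; exfalso.
  have k0 : k != 0 by apply: contra_neq u_neq_v => k0; rewrite vk k0 addr0.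
  move: uv; rewrite vk addrAC subrr add0r -intr_norm ltrz1; lia.
case: xgetP => [l -> [_ /(_ `|v - u|)]|_]; last exact: normr_ge0.
by apply; exists (v - u) => //=; rewrite flow_unit_point subrKC.
Qed.

Lemma step_length_ge0 w w' : admissible_step w w' -> 0 <= step_length w w'.
Proof.
have [a [u [/andP[u0 u1] ->]]] := unit_point_surj w => adm.
have [|b [v [_ h]]] := step_length_ge _ adm; first by apply/andP; split; lra.
by apply: le_trans h; rewrite addr_ge0// divr_ge0// dist_ge0.
Qed.

Definition chain_length w (s : seq X1) : R :=
  \sum_(c <- pairmap (@step_length R) w s) c.

Local Notation is_chain := (path (fun w w' : X1 => `[< admissible_step w w' >])).

Lemma chain_length_ge0 w s : is_chain w s -> 0 <= chain_length w s.
Proof.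
rewrite /chain_length; elim: s w => [|w' s IH] w /=; first by rewrite big_nil.
by move=> /andP[/asboolP adm /IH]; rewrite big_cons => ?; rewrite addr_ge0// step_length_ge0.
Qed.

(** The two bounds leave room for the whole length, so no intermediate point leaves the window
    required by [step_length_ge]; triangle inequalities then add up the steps. *)
Lemma chain_length_ge s a u : is_chain (unit_point a u) s ->
  -(1 / 2) <= u - chain_length (unit_point a u) s ->
  u + chain_length (unit_point a u) s <= 3 / 2 ->
  exists b v, last (unit_point a u) s = unit_point b v /\
    `|v - u| + dist a b / 4 <= chain_length (unit_point a u) s.
Proof.
rewrite /chain_length; elim: s a u => [|w s IH] a u /=.
  by rewrite big_nil => _ _ _; exists a, u; rewrite subrr normr0 dist_refl mul0r addr0.
move=> /andP[/asboolP adm chain]; rewrite !big_cons => lo hi.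
have l0 := step_length_ge0 adm; have := chain_length_ge0 chain.
rewrite /chain_length => s0.
have [|b [v [wE hv]]] := step_length_ge _ adm; first by apply/andP; split; lra.
move: l0 s0 hv chain lo hi; rewrite wE; move: (step_length _ _) => l l0 s0 hv chain lo hi.
have d1 := dist_ge0 R a b; have v1 := ler_norm (v - u); have v2 := ler_norm (u - v).
rewrite distrC in v2.
have [||c [x [-> hx]]] := IH b v chain; [lra|lra|].
exists c, x; split=> //; have := dist_triangle R b a c; have := ler_distD v x u.
by lra.
Qed.

Lemma rho0_set_neq0 w w' :
  [set l | exists s, [/\ is_chain w s, last w s = w' & l = chain_length w s]] !=set0.
Proof.
have [a [u [hu ->]]] := unit_point_surj w; have [b [v [hv ->]]] := unit_point_surj w'.
pose s := [:: unit_point a v; unit_point b v].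
exists (chain_length (unit_point a u) s), s; split=> //=.
rewrite andbT; apply/andP; split; apply/asboolP.
  by right; exists (v - u); rewrite flow_unit_point subrKC.
by left; exact: horizontal_length_unit_point.
Qed.

Lemma rho0_ge a u w l : 0 <= u <= 1 -> l <= 1 / 2 -> rho0 (unit_point a u) w < l ->
  exists b v, w = unit_point b v /\ `|v - u| + dist a b / 4 < l.
Proof.
move=> /andP[u0 u1] l1 /(inf_lt (@rho0_set_neq0 _ _))[_ [s [chain <- ->]] sl].
rewrite -/(chain_length _ _) in sl.
have [||b [v [-> h]]] := chain_length_ge chain; [lra|lra|].
by exists b, v; split=> //; exact: le_lt_trans sl.
Qed.

(** Tested on one chain: horizontally at height [u], then vertically over [b]. *)
Lemma rho0_le a b u v : 0 <= u <= 1 -> `|v - u| < 1 ->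
  rho0 (unit_point a u) (unit_point b v) <= 4 * dist a b + `|v - u|.
Proof.
move=> hu huv; pose s := [:: unit_point b u; unit_point b v].
apply: (@le_trans _ _ (chain_length (unit_point a u) s)).
  apply: ge_inf; first by exists 0 => _ [s' [chain _ ->]]; exact: chain_length_ge0.
  exists s; split=> //=; rewrite andbT; apply/andP; split; apply/asboolP.
    by left; exact: horizontal_length_unit_point.
  by right; exists (v - u); rewrite flow_unit_point subrKC.
rewrite /chain_length /= !big_cons big_nil addr0.
by rewrite lerD// ?step_length_horizontal_le ?step_length_vertical_le.
Qed.

End UnitSuspension.

(** * Comparison of the metric with orbit coordinates *)

Section MetricBounds.
Variables (R : realType) (tau : Sigma -> R) (m M : R).
Hypothesis m_gt0 : 0 < m.
Hypothesis tau_ge : forall a, m <= tau a.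
Hypothesis tau_le : forall a, tau a <= M.
Implicit Types (a b : Sigma) (r s h : R).

Local Notation dist := (dist R).
Local Notation pt := (orbit_point m_gt0 tau_ge).

Let tau_gt0 a : 0 < tau a. Proof. exact: lt_le_trans (tau_ge a). Qed.

Lemma rescale_point a h : 0 <= h <= tau a ->
  rescale (pt a h) = unit_point a (h / tau a).
Proof.
move=> hh; rewrite (@orbit_pointE _ _ _ _ _ (column_of hh) _ 0) ?shift0 ?roof_sum0 ?addr0//.
by rewrite rescale_pi// (pi_column (@ltr01 R) (fun _ : Sigma => lexx (1 : R))).
Qed.

(** The smallness condition lets [r] leave the column of [b] through at most one roof, below or
    above. The base [b] is kept, so [v] may leave the unit interval. *)
Lemma rescale_near_column a b s r : 0 <= s <= tau a ->
  `|r - s| + `|tau a - tau b| < m ->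
  exists v, rescale (pt b r) = unit_point b v /\
    `|v - s / tau a| <= (`|r - s| + `|tau a - tau b|) / m.
Proof.
move=> /andP[s0 sa] small.
have rs1 := ler_norm (r - s); have rs2 := ler_norm (s - r); rewrite distrC in rs2.
have ab1 := ler_norm (tau a - tau b); have ab2 := ler_norm (tau b - tau a); rewrite distrC in ab2.
have quo x a' : 0 <= x -> x / tau a' <= x / m.
  by move=> x0; rewrite ler_wpM2l// lef_pV2 ?posrE.
have quo0 x a' : 0 <= x -> 0 <= x / tau a'.
  by move=> x0; rewrite divr_ge0// ltW.
have [r0|r0] := ltP r 0.
  have t1 := tau_ge (shift (- 1) b).
  have e : roof_sum tau b (- 1) = - tau (shift (- 1) b).
    by rewrite /= big_ord1.
  exists (r / tau (shift (- 1) b)).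
  rewrite -[r in pt b r](subrK (roof_sum tau b (- 1))) orbit_point_shift e opprK.
  rewrite rescale_point; last by apply/andP; split; lra.
  rewrite -unit_point_shift mulrDl divff ?gt_eqF// rmorphN addrK; split=> //.
  have := quo0 s a s0; have := quo s a s0.
  have := quo0 (- r) (shift (- 1) b) ltac:(lra); have := quo (- r) (shift (- 1) b) ltac:(lra).
  have := divr_ge0 (normr_ge0 (tau a - tau b)) (ltW m_gt0).
  have : (s - r) / m <= `|r - s| / m by rewrite ler_pM2r ?invr_gt0.
  rewrite mulrBl !mulNr mulrDl => *; rewrite ler_norml; apply/andP; split; lra.
have [rb|rb] := ltP (tau b) r.
  have t1 := tau_ge (shift 1 b).
  exists (1 + (r - tau b) / tau (shift 1 b)).
  rewrite -[r in pt b r](subrK (roof_sum tau b 1)) orbit_point_shift roof_sum1.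
  rewrite rescale_point; last by apply/andP; split; lra.
  rewrite -unit_point_shift addrC; split=> //.
  have := quo0 (r - tau b) (shift 1 b) ltac:(lra); have := quo (r - tau b) (shift 1 b) ltac:(lra).
  have := quo0 (tau a - s) a ltac:(lra); have := quo (tau a - s) a ltac:(lra).
  have : (r - s + (tau a - tau b)) / m <= (`|r - s| + `|tau a - tau b|) / m.
    by rewrite ler_pM2r ?invr_gt0//; lra.
  rewrite !mulrBl divff ?gt_eqF// mulrDl mulrBl => *.
  by rewrite ler_norml; apply/andP; split; lra.
exists (r / tau b); rewrite rescale_point ?r0//; split=> //.
have -> : r / tau b - s / tau a = (r - s + s / tau a * (tau a - tau b)) / tau b.
  by field; rewrite !gt_eqF.
rewrite normrM normfV (gtr0_norm (tau_gt0 b)).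
apply: le_trans (quo _ b (normr_ge0 _)) _; rewrite ler_pM2r ?invr_gt0//.
rewrite (le_trans (ler_normD _ _))// lerD2l normrM ler_piMl//.
by rewrite ger0_norm ?divr_ge0// ?ler_pdivrMr ?mul1r// ltW.
Qed.

Lemma rho_le a b s r : 0 <= s <= tau a -> `|r - s| + `|tau a - tau b| < m ->
  rho (pt a s) (pt b r) <=
    4 * dist a b + (`|r - s| + `|tau a - tau b|) / m.
Proof.
move=> hs small; have [v [e hv]] := rescale_near_column hs small.
rewrite /rho e rescale_point//; apply: le_trans (rho0_le _ _ _ _) _.
- by move: hs => /andP[s0 sa]; rewrite divr_ge0 ?(ltW (tau_gt0 a))//= ler_pdivrMr ?mul1r.
- by apply: le_lt_trans hv _; rewrite ltr_pdivrMr ?mul1r.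
- by rewrite lerD2l.
Qed.

(** For [l <= 1 / 2] at most one roof is crossed, so [n] is -1, 0 or 1. The roof difference enters
    because the two columns are rescaled by different roofs. *)
Lemma rho_ge a s y l : 0 <= s <= tau a -> l <= 1 / 2 -> rho (pt a s) y < l ->
  exists b r, [/\ y = pt b r, dist a b <= 4 * l &
    `|r - s| <= M * l + `|tau a - tau b|].
Proof.
move=> /andP[s0 sa]; set u := s / tau a => l1.
have su : s = u * tau a by rewrite divfK// gt_eqF.
have u0 : 0 <= u by rewrite divr_ge0// ltW.
have u1 : u <= 1 by rewrite ler_pdivrMr ?mul1r.
have [b' [k [/andP[k0 k1] ->]]] := orbit_point_surj m_gt0 tau_ge y.
rewrite /rho !rescale_point ?s0 ?k0// -/u => /(rho0_ge _ l1).
case=> [|b [v [/unit_point_eq[n [-> kv]] h]]]; first by rewrite u0.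
have l0 := dist_ge0 R a (shift n b'); have vu := normr_ge0 (v - u).
exists (shift n b'), (k - roof_sum tau b' n).
have {kv} kv : k = (v + n%:~R) * tau b' by rewrite -kv divfK// gt_eqF.
have v1 : `|v - u| <= l by lra.
have vn0 : 0 <= v + n%:~R by rewrite -(pmulr_lge0 _ (tau_gt0 b')) -kv.
have vn1 : v + n%:~R <= 1 by rewrite -(ler_pM2r (tau_gt0 b')) -kv mul1r.
split; [by rewrite -orbit_point_shift subrK|by lra|].
have {l0 vu h} := v1; rewrite ler_norml => /andP[vl vr].
have n1 : (absz n <= 1)%N by rewrite -abszN; apply: (@fractional_index _ (- n) v); rewrite ?rmorphN ?opprK; lra.
have t1 := tau_ge b'; have t2 := tau_le b'; have ta1 := tau_ge a; have ta2 := tau_le a.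
have scaled x c : -l <= x <= l -> - (M * l) <= x * tau c <= M * l.
  move=> /andP[x0 x1]; have := tau_gt0 c; have := tau_le c => c1 c2.
  have l0 : 0 <= l by lra.
  have : l * tau c <= l * M by rewrite ler_wpM2l.
  have : x * tau c <= l * tau c by rewrite ler_wpM2r// ltW.
  have : - l * tau c <= x * tau c by rewrite ler_wpM2r// ltW.
  by move=> *; apply/andP; split; lra.
(* For a path crossing a roof: its pieces on the two sides, scaled by different roofs, total at most
   [M * l]. *)
have both x z c d : 0 <= x -> 0 <= z -> x + z <= l ->
    0 <= x * tau c + z * tau d /\ x * tau c + z * tau d <= M * l.
  move=> x0 z0 xz; have c1 := tau_gt0 c; have c2 := tau_le c.
  have d1 := tau_gt0 d; have d2 := tau_le d.
  have := mulr_ge0 x0 (ltW c1); have := mulr_ge0 z0 (ltW d1).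
  have : x * tau c <= x * M by rewrite ler_wpM2l.
  have : z * tau d <= z * M by rewrite ler_wpM2l.
  have : (x + z) * M <= l * M by rewrite ler_wpM2r//; lra.
  by split; lra.
have dtau c : u * (tau c - tau a) <= `|tau a - tau c| /\
    - `|tau a - tau c| <= u * (tau c - tau a).
  have : `|u * (tau c - tau a)| <= `|tau a - tau c|.
    by rewrite normrM (ger0_norm u0) distrC ler_piMl.
  by rewrite ler_norml => /andP[].
have /orP[/orP[/eqP n0|/eqP n0]|/eqP n0] : (n == 0) || (n == 1) || (n == -1).
  by clear -n1; lia.
- rewrite n0 roof_sum0 subr0 kv n0 addr0 shift0 su.
  have /andP[] := scaled (v - u) b' ltac:(lra); have [] := dtau b'.
  by rewrite ler_norml; move=> *; apply/andP; split; lra.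
- rewrite n0 roof_sum1 kv n0 su mulrDl mul1r addrK.
  rewrite n0 in vn0 vn1.
  rewrite -[1%:~R]/(1 : R) in vn0 vn1.
  have := normr_ge0 (tau a - tau (shift 1 b')).
  have [] := both (- v) u b' a; [lra|lra|lra|].
  by rewrite ler_norml; move=> *; apply/andP; split; lra.
- have -> : roof_sum tau b' n = - tau (shift (-1) b') by rewrite n0 /= big_ord1.
  rewrite kv n0 opprK su; rewrite n0 in vn0 vn1.
  rewrite (_ : (-1)%:~R = -1 :> R)// in vn0 vn1 *.
  have [] := both (v - 1) (1 - u) b' a; [lra|lra|lra|].
  have := ler_norm (tau a - tau (shift (-1) b')).
  have := ler_norm (tau (shift (-1) b') - tau a).
  by rewrite [`|tau (shift _ _) - _|]distrC ler_norml; move=> *; apply/andP; split; lra.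
Qed.

End MetricBounds.

(** * Hölder roofs *)

(** The intermediate [c] agrees with [a] from [- N] on and with [b] up to [N]. Contracting [N] times
    along such a half-line bounds each distance by [1 / 2 ^+ N]. *)
Lemma dist_cylinder (R : realType) (N : nat) (a b : Sigma) :
  (forall i : int, (absz i <= N)%N -> a i = b i) -> dist R a b <= 2 / 2 ^+ N.
Proof.
move=> ab; pose c : Sigma := fun i => if 0 <= i then a i else b i.
have one_sided s (x y : Sigma) : absz s = 1%N ->
    (forall i, - N%:Z <= s * i -> x i = y i) -> dist R x y <= 1 / 2 ^+ N.
  move=> s1 xy; have sN : s * N%:Z + - (s * N%:Z) = 0 by rewrite subrr.
  have := @dist_shift_contractX R N s (shift (- (s * N%:Z)) x) (shift (- (s * N%:Z)) y) s1.
  rewrite !shiftD sN !shift0 => /(_ _)/le_trans -> //.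
    by move=> i si; apply: xy; nia.
  by rewrite ler_pM2r ?invr_gt0 ?exprn_gt0// dist_le1.
have ac := one_sided 1 a c erefl.
have cb := one_sided (- 1) c b erefl.
have := dist_triangle R c a b.
have {}ac : dist R a c <= 1 / 2 ^+ N.
  by apply: ac => i; rewrite /c; case: ifP => // i0 iN; apply: ab; lia.
have {}cb : dist R c b <= 1 / 2 ^+ N.
  by apply: cb => i; rewrite /c; case: ifP => // i0 iN; apply: ab; lia.
by rewrite (_ : 2 / 2 ^+ N = 1 / 2 ^+ N + 1 / 2 ^+ N :> R); [lra|rewrite -mulrDl].
Qed.

(** A compactness argument: sequences on which [tau] tends to 0 would accumulate at some [c], where
    continuity contradicts [0 < tau c]. *)
Lemma uniformly_continuous_pos_lower_bound (R : realType) (tau : Sigma -> R) :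
  (forall a, 0 < tau a) ->
  (forall e : R, 0 < e -> exists2 eta : R, 0 < eta &
    forall a b, dist R a b <= eta -> `|tau a - tau b| <= e) ->
  exists2 m : R, 0 < m & forall a, m <= tau a.
Proof.
move=> tau_gt0 tau_uc; apply: contrapT => H.
have bad n : exists a, tau a < n.+1%:R^-1.
  apply: contrapT => /forallNP na; apply: H; exists n.+1%:R^-1 => // a.
  by rewrite leNgt; apply/negP.
have [u hu] := choice bad.
(* [c] is the coordinatewise limit of the near-minimizers along an ultrafilter. *)
have [G [GU oG]] := @ultraFilterLemma nat (\oo) _.
pose c : Sigma := fun i => `[< G [set n | u n i] >].
have Gc i : G [set n | u n i = c i].
  rewrite /c; case: asboolP => [|nG]; first by apply: filterS => n /= ->.
  have [//|] := in_ultra_setVsetC [set n | u n i] GU.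
  by apply: filterS => n /= /negP/negbTE.
have Gcyl N : G [set n | forall i : int, (absz i <= N)%N -> u n i = c i].
  elim: N => [|N IH].
    by apply: filterS (Gc 0) => n /= h i i0; rewrite (_ : i = 0)//; lia.
  apply: filterS3 IH (Gc N.+1%:Z) (Gc (- N.+1%:Z)) => n /= h1 h2 h3 i iN.
  have [/h1//|iN'] := leqP (absz i) N.
  by have [->|->] : i = N.+1%:Z \/ i = - N.+1%:Z by lia.
have [eta eta0 heta] := tau_uc (tau c / 2) ltac:(by rewrite divr_gt0).
have [N hN] : exists N : nat, 2 / 2 ^+ N <= eta.
  exists (Num.trunc (2 / eta)).+1; rewrite ler_pdivrMr ?exprn_gt0//.
  rewrite mulrC -ler_pdivrMr// (le_trans (ltW (truncnS_gt _)))//.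
  by rewrite -natrX ler_nat ltnW// ltn_expl.
pose K := Num.trunc (2 / tau c).
have GK : G [set n | (K <= n)%N] by apply: oG; exact: nbhs_infty_ge.
have [n [/= nc nK]] := filter_ex (filterI (Gcyl N) GK).
have := heta (u n) c (le_trans (dist_cylinder R nc) hN).
rewrite ler_norml => /andP[h _]; have := hu n.
have : n.+1%:R^-1 <= tau c / 2.
  rewrite -[leRHS]invrK lef_pV2 ?posrE// ?invr_gt0 ?divr_gt0//.
  rewrite invf_div (le_trans (ltW (truncnS_gt _)))// ler_nat.
  exact: nK.
move=> n1 n2; have := lt_le_trans n2 n1; have := tau_gt0 c; lra.
Qed.

Lemma geometric_tail (R : realType) (f : nat -> R) (K q : R) : 0 <= q < 1 ->
  (forall k, `|f k| <= K * q ^+ k) ->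
  exists l, forall n, `|l - \sum_(k < n) f k| <= K / (1 - q) * q ^+ n.
Proof.
move=> /andP[q0 q1] hf.
have K0 : 0 <= K by have := hf 0%N; rewrite expr0 mulr1; exact: le_trans.
have tail n j : `|\sum_(k < n + j) f k - \sum_(k < n) f k| <= K / (1 - q) * q ^+ n.
  (* The sharper telescoping bound is the one that passes through the induction on [j]. *)
  suff : `|\sum_(k < n + j) f k - \sum_(k < n) f k| <= K / (1 - q) * (q ^+ n - q ^+ (n + j)).
    move=> /le_trans -> //; rewrite ler_wpM2l ?divr_ge0 ?subr_ge0 ?(ltW q1)//.
    by rewrite gerBl exprn_ge0.
  elim: j => [|j IH]; first by rewrite addn0 !subrr normr0 mulr0.
  rewrite addnS big_ord_recr /= addrAC (le_trans (ler_normD _ _))//.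
  rewrite (le_trans (lerD IH (hf _)))// le_eqVlt; apply/orP; left; apply/eqP.
  by rewrite exprS; field; rewrite subr_eq0 gt_eqF.
have cf : cvgn (series f).
  apply: normed_cvg; apply: (@series_le_cvg _ _ (geometric K q)) => //.
  - by move=> n; exact: normr_ge0.
  - by move=> n; rewrite /geometric /= mulr_ge0// exprn_ge0.
  - by apply: is_cvg_geometric_series; rewrite ger0_norm.
exists (limn (series f)) => n; apply/ler_addgt0Pl => e e0.
have /cvgrPdist_le/(_ e e0)[N _ hN] := cf.
have := hN (n + N)%N (leq_addl _ _); rewrite /series /= big_mkord => h.
by rewrite (le_trans (ler_distD (\sum_(k < n + N) f k) _ _))// lerD.
Qed.

Section Holder.
Variables (R : realType) (tau : Sigma -> R) (L alpha : R).
Hypotheses (L_ge1 : 1 <= L) (alpha_gt0 : 0 < alpha).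
Hypothesis tau_holder : forall a b, `|tau a - tau b| <= L * powR (dist R a b) alpha.

Lemma powR_small (e : R) : 0 < e ->
  exists2 eta : R, 0 < eta & forall x, 0 <= x <= eta -> powR x alpha <= e.
Proof.
move=> e0; exists (powR e alpha^-1); first exact: powR_gt0.
move=> x /andP[x0 xe].
have -> : e = powR (powR e alpha^-1) alpha.
  by rewrite -powRrM mulVf ?gt_eqF// powRr1// ltW.
by rewrite ge0_ler_powR ?nnegrE ?powR_ge0// ltW.
Qed.

Lemma holder_uniformly_continuous (e : R) : 0 < e -> exists2 eta : R, 0 < eta &
  forall a b, dist R a b <= eta -> `|tau a - tau b| <= e.
Proof.
move=> e0; have L0 : 0 < L by exact: lt_le_trans L_ge1.
have [eta eta0 h] := @powR_small (e / L) ltac:(by rewrite divr_gt0).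
exists eta => // a b ab; apply: le_trans (tau_holder a b) _.
by rewrite mulrC -ler_pdivlMr// h// dist_ge0.
Qed.

Lemma holder_upper_bound a : tau a <= tau (fun=> false) + L.
Proof.
have := tau_holder a (fun=> false); have := ler_norm (tau a - tau (fun=> false)).
have : L * powR (dist R a (fun=> false)) alpha <= L.
  rewrite ler_piMr//; first by apply: le_trans L_ge1.
  have := ge0_ler_powR (ltW alpha_gt0) _ _ (dist_le1 R a (fun=> false)).
  by rewrite powR1; apply; rewrite nnegrE ?dist_ge0.
lra.
Qed.

(** The factor by which the Hölder bound shrinks when a distance is halved. *)
Definition rate : R := powR 2^-1 alpha.

Lemma rate_bounds : 0 < rate < 1.
Proof.
rewrite powR_gt0 ?invr_gt0//=.
have h : (2^-1 : R) < 1 by rewrite invf_lt1// ltr1n.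
have := gt0_ltr_powR alpha_gt0 _ _ h.
by rewrite powR1; apply; rewrite nnegrE ?invr_ge0.
Qed.

(** Along agreeing half-orbits distances halve at each step, so the roof differences are dominated
    by a geometric series; [l] is their sum and the estimate bounds the tail. *)
Lemma asymptotic_offset (e : R) : 0 < e -> exists2 eta : R, 0 < eta &
  forall (s : int) a c, absz s = 1%N -> (forall i, 0 <= s * i -> a i = c i) ->
  dist R a c <= eta -> exists l, forall n : nat,
  `|l + roof_sum tau c (s * n%:Z) - roof_sum tau a (s * n%:Z)| <= e * rate ^+ n.
Proof.
move=> e0; have L0 : 0 < L by exact: lt_le_trans L_ge1.
have /andP[q0 q1] := rate_bounds.
(* Dividing by [L] absorbs the Hölder constant, and [1 - rate] cancels the denominator in
   [geometric_tail]. *)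
have [eta eta0 h] := @powR_small (e * (1 - rate) / L) ltac:(by rewrite divr_gt0// mulr_gt0// subr_gt0).
exists eta => // s a c s1 ac dac.
pose T b n := roof_sum tau b (s * n%:Z).
pose f k := (T a k.+1 - T a k) - (T c k.+1 - T c k).
have [||l hl] := @geometric_tail R f (e * (1 - rate)) rate; first by rewrite q1 ltW.
  (* The [k]-th increment reads the roof at index [k] forwards, but at [- (k + 1)] backwards. *)
  move=> k; pose j : int := if s == 1 then k%:Z else - k.+1%:Z.
  have fE : `|f k| = `|tau (shift j a) - tau (shift j c)|.
    have [s_eq|s_eq] : s = 1 \/ s = -1 by lia.
      rewrite /f /j s_eq eqxx /T s_eq !mul1r -addn1 PoszD !roof_sumS.
      by congr `|_|; ring.
    rewrite /f /j /T s_eq !mulN1r (_ : (-1 == 1 :> int) = false)//.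
    have e2 : - k%:Z = - k.+1%:Z + 1 by lia.
    rewrite e2 !roof_sumS [RHS]distrC; congr `|_|; ring.
  rewrite fE (le_trans (tau_holder _ _))//.
  have djk : dist R (shift j a) (shift j c) <= eta * 2^-1 ^+ k.
    have [n nj kn] : exists2 n : nat, j = s * n%:Z & (k <= n)%N.
      rewrite /j; case: ifP => [/eqP ->|/eqP s_neq1]; first by exists k; rewrite ?mul1r.
      by exists k.+1 => //; lia.
    rewrite nj (le_trans (dist_shift_contractX R n s1 ac))// -exprVn.
    rewrite ler_pM ?dist_ge0 ?exprn_ge0 ?invr_ge0//.
    by rewrite ler_wiXn2l// ?invr_ge0// invf_le1// ler1n.
  suff small : powR (dist R (shift j a) (shift j c)) alpha <= e * (1 - rate) / L * rate ^+ k.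
    rewrite (le_trans (ler_wpM2l (ltW L0) small))//.
    by rewrite mulrA [L * _]mulrC divfK ?gt_eqF.
  have half0 : 0 <= (2^-1 : R) ^+ k by rewrite exprn_ge0 ?invr_ge0.
  have := ge0_ler_powR (ltW alpha_gt0) _ _ djk; rewrite !nnegrE dist_ge0.
  rewrite mulr_ge0 ?(ltW eta0)// => /(_ erefl erefl)/le_trans; apply.
  rewrite powRM ?(ltW eta0)//.
  have -> : powR (2^-1 ^+ k) alpha = rate ^+ k.
    by rewrite /rate -[RHS]powR_mulrn ?powR_ge0// -powRrM mulrC powRrM powR_mulrn ?invr_ge0.
  by rewrite ler_wpM2r ?exprn_ge0 ?(ltW q0)// h// lexx ltW.
exists l => n; have := hl n; rewrite mulfK ?subr_eq0 ?gt_eqF//.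
suff -> : \sum_(k < n) f k = T a n - T c n by rewrite opprB addrA.
elim: n => [|n IH]; first by rewrite big_ord0 /T mulr0 !roof_sum0 subrr.
by rewrite big_ord_recr /= IH /f; ring.
Qed.

End Holder.

(** * Stable and unstable sets *)

Lemma ex_pos_le4 (R : realType) (x y z w : R) : 0 < x -> 0 < y -> 0 < z -> 0 < w ->
  exists2 e : R, 0 < e & [/\ e <= x, e <= y, e <= z & e <= w].
Proof.
move=> x0 y0 z0 w0; exists (Num.min (Num.min x y) (Num.min z w)).
  by rewrite !lt_min x0 y0 z0.
by rewrite !ge_min !lexx ?orbT.
Qed.

Lemma ex_expr_le (R : realType) (q e : R) : 0 < q < 1 -> 0 < e ->
  exists N : nat, forall n, (N <= n)%N -> q ^+ n <= e.
Proof.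
move=> /andP[q0 q1] e0.
have /cvgrPdist_le/(_ e e0)[N _ hN] := @cvg_expr R q ltac:(by rewrite gtr0_norm).
exists N => n Nn; have := hN n Nn; rewrite /= sub0r normrN.
exact: le_trans (ler_norm _).
Qed.

Lemma sign_sqr (s : int) : absz s = 1%N -> s * s = 1.
Proof. by move=> s1; have [->|->] : s = 1 \/ s = -1 by lia. Qed.

Lemma sign_absz (s i : int) : absz s = 1%N -> 0 <= s * i -> s * (absz i)%:Z = i.
Proof.
move=> s1; have [->|->] : s = 1 \/ s = -1 by lia.
  by lia.
by lia.
Qed.

Lemma roof_sum_upper (R : realType) (tau : Sigma -> R) (M : R) :
  (forall a, tau a <= M) -> forall a (n : int),
  if 0 <= n then roof_sum tau a n <= M * n%:~R else M * n%:~R <= roof_sum tau a n.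
Proof.
move=> tau_le a n; have up b (j : nat) : roof_sum tau b j%:Z <= M * j%:R.
  elim: j => [|j IH]; first by rewrite mulr0 roof_sum0.
  by rewrite -addn1 PoszD roof_sumS natrD mulrDr mulr1 lerD.
case: ifPn => n0; first by rewrite -[n in leLHS]gez0_abs// (le_trans (up _ _))// pmulrn gez0_abs.
have := up (shift n a) (absz n); rewrite -abszN gez0_abs; last by lia.
rewrite roof_sumN pmulrn gez0_abs; last by lia.
by rewrite rmorphN /=; lra.
Qed.

Section Dynamics.
Variables (R : realType) (tau : Sigma -> R) (m M : R).
Hypothesis m_gt0 : 0 < m.
Hypothesis tau_ge : forall a, m <= tau a.
Hypothesis tau_le : forall a, tau a <= M.
Hypothesis tau_uc : forall e : R, 0 < e -> exists2 eta : R, 0 < eta &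
  forall a b : Sigma, dist R a b <= eta -> `|tau a - tau b| <= e.
Implicit Types (a b c : Sigma) (r h t e : R) (s n j : int) (x y z : suspension tau).

Local Notation dist := (dist R).
Local Notation pt := (orbit_point m_gt0 tau_ge).
Local Notation T := (roof_sum tau).

Let tau_gt0 a : 0 < tau a. Proof. exact: lt_le_trans (tau_ge a). Qed.

Let M_gt0 : 0 < M. Proof. exact: lt_le_trans (tau_le (fun=> false)). Qed.

Lemma rho_small e : 0 < e -> exists2 eta : R, 0 < eta & forall a b r h,
  0 <= r <= tau a -> dist a b <= eta -> `|h - r| <= eta ->
  rho (pt a r) (pt b h) <= e.
Proof.
(* In the bound of [rho_le], the base and the heights may each use [e / 2]; [m / 4] secures its
   smallness condition. *)
move=> e0; have me0 : 0 < m * e / 4 by rewrite !mulr_gt0.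
have [e1 e10 [e1a e1b _ _]] := @ex_pos_le4 R _ (m / 4) _ _ me0 ltac:(by rewrite divr_gt0) e0 e0.
have [eta1 eta10 h1] := tau_uc e10.
have [eta eta0 [ha hb hc _]] := @ex_pos_le4 R _ _ (e / 8) _ eta10 e10 ltac:(by rewrite divr_gt0) e10.
exists eta => // a b r h hr ab rh.
have t1 := h1 a b (le_trans ab ha).
have small : `|h - r| + `|tau a - tau b| <= m * e / 2 by lra.
apply: le_trans (rho_le _ _ hr _) _; first by lra.
have : (`|h - r| + `|tau a - tau b|) / m <= e / 2 by rewrite ler_pdivrMr//; lra.
by lra.
Qed.

Lemma near_of_rho_small e : 0 < e -> exists2 eta : R, 0 < eta & forall a r y,
  0 <= r <= tau a -> rho (pt a r) y <= eta ->
  exists b h, [/\ y = pt b h, dist a b <= e & `|h - r| <= e].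
Proof.
move=> e0; have [eta1 eta10 h1] := @tau_uc (e / 2) ltac:(by rewrite divr_gt0).
have [l l0 [la lb lc ld]] := @ex_pos_le4 R (1 / 2) (e / 2 / M) (eta1 / 4) (e / 4)
  ltac:(by rewrite divr_gt0) ltac:(by rewrite !divr_gt0) ltac:(by rewrite divr_gt0)
  ltac:(by rewrite divr_gt0).
exists (l / 2); first by rewrite divr_gt0.
move=> a r y hr hy.
have hl : rho (pt a r) y < l by lra.
have [b [h [-> ab hrh]]] := rho_ge tau_le hr la hl.
exists b, h; split=> //; first by lra.
have t1 : `|tau a - tau b| <= e / 2 by apply: h1; lra.
by move: lb; rewrite ler_pdivlMr// mulrC; lra.
Qed.

(** At this time the first point is at height 0 over [shift j c]. The second has a nearby
    representative of some index [k], and [roof_sum_sep] excludes [k != j] while the offset stays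
    below [m - e]. *)
Lemma near_at_roof e : 0 < e -> exists2 eta : R, 0 < eta & forall c r a h j,
  `|h - r + T c j - T a j| < m - e ->
  rho (flow (T c j - r) (pt c r)) (flow (T c j - r) (pt a h)) <= eta ->
  `|h - r + T c j - T a j| <= e /\ dist (shift j c) (shift j a) <= e.
Proof.
move=> e0; have [eta eta0 near] := near_of_rho_small e0; exists eta => // c r a h j hD.
rewrite !flow_point subrKC -[T c j]add0r orbit_point_shift add0r.
move=> hrho; have [|b [h' [/orbit_point_eq[k [-> hk]] cb h0]]] := near (shift j c) 0 _ _ hrho.
  by rewrite lexx ltW.
have kj : j = k.
  apply/eqP; apply: contraLR hD => /(roof_sum_sep m_gt0 tau_ge a).
  rewrite subr0 in h0; rewrite -leNgt => jk.
  have -> : h - r + T c j - T a j = h' - (T a j - T a k) by lra.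
  by have := ler_normB h' (h' - (T a j - T a k)); rewrite subKr; lra.
have -> : h - r + T c j - T a j = h' by move: hk; rewrite -kj; lra.
by rewrite -kj in cb; rewrite subr0 in h0.
Qed.

Lemma roof_sum_step c s j : absz s = 1%N ->
  T c (s + j) - T c j = s%:~R * tau (shift (if s == 1 then j else s + j) c).
Proof.
move=> s1; have [->|->] : s = 1 \/ s = -1 by lia.
  by rewrite eqxx [1 + j]addrC roof_sumS mul1r; ring.
have -> : T c j = T c (-1 + j + 1) by congr (T c _); lia.
by rewrite roof_sumS rmorphN mulN1r /=; lra.
Qed.

Lemma roof_sum_step_near e : 0 < e -> exists2 eta : R, 0 < eta & forall s j a c,
  absz s = 1%N -> dist (shift j c) (shift j a) <= eta ->
  `|(T c (s + j) - T c j) - (T a (s + j) - T a j)| <= e.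
Proof.
(* A backward step reads the roof one shift further, which may double the distance. *)
move=> e0; have [eta eta0 h] := tau_uc e0; exists (eta / 2); first by rewrite divr_gt0.
move=> s j a c s1 ca; rewrite !roof_sum_step// -mulrBr normrM.
have -> : `|s%:~R| = 1 :> R by rewrite -intr_norm; have -> : `|s| = 1 by lia.
rewrite mul1r; apply: h; case: ifP => _.
  by have := dist_ge0 R (shift j c) (shift j a); lra.
by rewrite -!shiftD; have := dist_shift1 R (shift j c) (shift j a) s1; lra.
Qed.

Lemma roof_time_sign s c r (n : nat) : absz s = 1%N -> 0 <= r <= tau c ->
  (0 < n)%N -> m * (n%:R - 1) <= s%:~R * (T c (s * n%:Z) - r).
Proof.
move=> s1 /andP[r0 r1] n0; have [->|->] : s = 1 \/ s = -1 by lia.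
  rewrite !mul1r; have -> : n%:Z = 1 + (n%:Z - 1) by lia.
  rewrite roof_sumD roof_sum1.
  have := roof_sum_ge tau_ge (shift 1 c) (n := n%:Z - 1) ltac:(lia).
  by rewrite rmorphB /= -pmulrn; lra.
rewrite (_ : (-1)%:~R = -1 :> R)// !mulN1r.
have := roof_sum_le tau_ge c (n := - n%:Z) ltac:(lia).
by rewrite rmorphN mulrN /= -pmulrn mulrBr mulr1; move: m_gt0; lra.
Qed.

(** The stable ([s = 1]) and unstable ([s = -1]) conditions in one form, so that past and future
    share their proofs. *)
Definition asymptotic s e x z : Prop :=
  (forall e', 0 < e' -> exists B, forall t, B <= t ->
     rho (flow (s%:~R * t) z) (flow (s%:~R * t) x) <= e') /\
  forall t, 0 <= t -> rho (flow (s%:~R * t) z) (flow (s%:~R * t) x) <= e.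

(** The height of [(a, h)] above its [j]-th roof at the moment when [(c, r)] passes its own [j]-th
    roof. *)
Definition height_offset c r a h j : R := h - r + T c j - T a j.

Lemma offset_step e : 0 < e -> exists2 eta : R, 0 < eta & forall s c r a h j,
  absz s = 1%N -> dist (shift j c) (shift j a) <= eta ->
  `|height_offset c r a h (s + j) - height_offset c r a h j| <= e.
Proof.
move=> e0; have [eta eta0 H] := roof_sum_step_near e0; exists eta => //.
move=> s c r a h j s1 /(H s j a c s1); congr (`|_| <= _); rewrite /height_offset; ring.
Qed.

(** Comparing the two orbits at every roof passage keeps the shifted bases close, which forces equal
    symbols; the offsets inherit the decay of [rho]. *)
Lemma asymptotic_shadow e : 0 < e -> exists2 eta : R, 0 < eta & forall s c r x,
  absz s = 1%N -> 0 <= r <= tau c -> asymptotic s eta x (pt c r) ->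
  exists a h, [/\ x = pt a h, `|h - r| <= e, dist c a <= e,
    forall i, 0 <= s * i -> c i = a i &
    forall e', 0 < e' -> exists N, forall n : nat, (N <= n)%N ->
      `|height_offset c r a h (s * n%:Z)| <= e'].
Proof.
move=> e0; have [e2 e20 step] := @offset_step (m / 4) ltac:(by rewrite divr_gt0).
(* [e2] permits the next offset step, [m / 8] plus the step [m / 4] stays below [m - e1], and
   [1 / 4] is below the third that separates symbols. *)
have [e1 e10 [e1e e1e2 e1m e14]] := @ex_pos_le4 R e e2 (m / 8) (1 / 4) e0 e20
  ltac:(by rewrite divr_gt0) ltac:(by rewrite divr_gt0).
have [eta1 eta10 near0] := near_of_rho_small e10.
have at_roof e' := near_at_roof (e := e').
have [eta2 eta20 near1] := at_roof _ e10.
have [eta eta0 [eta_1 eta_2 _ _]] := @ex_pos_le4 R _ _ 1 1 eta10 eta20 ltr01 ltr01.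
exists eta => // s c r x s1 hr [xlim xbound].
have ss (u : R) : s%:~R * (s%:~R * u) = u.
  by rewrite mulrA -intrM; rewrite sign_sqr// mul1r.
have := xbound 0 (lexx _); rewrite mulr0 flow_point addr0.
have [a0 [h0 [_ x0]]] := orbit_point_surj m_gt0 tau_ge x.
rewrite {1}x0 flow_point addr0 -x0 => hx.
have [a [h [xE ca hrh]]] := near0 _ _ _ hr (le_trans hx eta_1).
have time_ge0 (n : nat) : (0 < n)%N -> 0 <= s%:~R * (T c (s * n%:Z) - r).
  move=> n0; apply: le_trans (roof_time_sign s1 hr n0).
  by rewrite mulr_ge0 ?(ltW m_gt0)// subr_ge0 ler1n.
(* When [z] reaches the [n]-th roof, [x] is near a roof of its own orbit; the
   offset changes too little in one step for that roof not to be the [n]-th. *)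
have inv (n : nat) : `|height_offset c r a h (s * n%:Z)| <= e1 /\
    dist (shift (s * n%:Z) c) (shift (s * n%:Z) a) <= e1.
  elim: n => [|n [IH1 IH2]]; first by rewrite mulr0 /height_offset !roof_sum0 !shift0 subr0 addr0.
  apply: near1; last first.
    have := xbound _ (time_ge0 n.+1 isT); rewrite ss xE => /le_trans; exact.
  have := step s c r a h _ s1 (le_trans IH2 e1e2).
  rewrite (_ : s + s * n%:Z = s * n.+1%:Z); last by clear; lia.
  rewrite -/(height_offset _ _ _ _ _) => st.
  have := ler_normD (height_offset c r a h (s * n.+1%:Z) - height_offset c r a h (s * n%:Z))
    (height_offset c r a h (s * n%:Z)).
  rewrite subrK; lra.
exists a, h; split=> //; try lra.
- move=> i si; have [_] := inv (absz i).
  rewrite sign_absz//.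
  move=> ci; have := @dist_lt_third R (shift i c) (shift i a).
  by rewrite /shift !add0r; apply; lra.
- move=> e' e'0.
  have [e3 e30 [e3e' e3m _ _]] := @ex_pos_le4 R e' (m / 8) 1 1 e'0 ltac:(by rewrite divr_gt0) ltr01 ltr01.
  have [eta3 eta30 near3] := at_roof _ e30.
  have [B hB] := xlim _ eta30.
  (* The [n]-th roof is reached no earlier than [m * (n - 1)], which must exceed [B]. *)
  exists (Num.trunc (`|B| / m)).+2 => n Nn.
  have n0 : (0 < n)%N by exact: leq_trans Nn.
  have [] := near3 c r a h (s * n%:Z); last by move=> h3 _; exact: le_trans h3 e3e'.
    by have [] := inv n; rewrite /height_offset; lra.
  have := hB (s%:~R * (T c (s * n%:Z) - r)); rewrite ss xE; apply.
  apply: le_trans (roof_time_sign s1 hr n0).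
  rewrite mulrC -ler_pdivrMr//.
  have : B / m <= `|B| / m by rewrite ler_pM2r ?invr_gt0// ler_norm.
  have := truncnS_gt (`|B| / m).
  have : (Num.trunc (`|B| / m)).+2%:R <= n%:R :> R by rewrite ler_nat.
  by rewrite -[X in X <= _]natr1; lra.
Qed.

(** Re-indexing by [k] turns one offset sequence into the other plus a constant. Both tend to 0, so
    the constant is 0. *)
Lemma offset_lim_unique s k c a r1 h1 r2 h2 : absz s = 1%N ->
  (forall e', 0 < e' -> exists N, forall n : nat, (N <= n)%N ->
      `|height_offset c r1 a h1 (s * n%:Z)| <= e') ->
  (forall e', 0 < e' -> exists N, forall n : nat, (N <= n)%N ->
      `|height_offset (shift k c) r2 (shift k a) h2 (s * n%:Z)| <= e') ->
  h1 - r1 = (h2 + T a k) - (r2 + T c k).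
Proof.
move=> s1 lim1 lim2; apply/eqP; rewrite -subr_eq0 -normr_le0.
apply/ler_addgt0Pl => e e0; rewrite addr0.
have e20 : 0 < e / 2 by rewrite divr_gt0.
have [N1 h1'] := lim1 _ e20; have [N2 h2'] := lim2 _ e20.
pose n := (N1 + N2 + absz k)%N.
have e1 : `|height_offset (shift k c) r2 (shift k a) h2 (s * n%:Z)| <= e / 2.
  by apply: h2'; rewrite /n; clear; lia.
have ssk : s * (s * k) = k by rewrite mulrA sign_sqr// mul1r.
have nk : 0 <= n%:Z + s * k.
  have : absz (s * k) = absz k by rewrite abszM s1 mul1n.
  by rewrite /n; move: (s * k) => j; clear; lia.
have idx : s * (absz (n%:Z + s * k))%:Z = s * n%:Z + k by rewrite gez0_abs// mulrDr ssk.
have e2 : `|height_offset c r1 a h1 (s * (absz (n%:Z + s * k))%:Z)| <= e / 2.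
  apply: h1'; have : absz (s * k) = absz k by rewrite abszM s1 mul1n.
  by move: nk; rewrite /n; move: (s * k) => j; clear; lia.
rewrite idx in e2; move: e1 e2; rewrite /height_offset.
have : T c (k + s * n%:Z) = T c k + T (shift k c) (s * n%:Z) by rewrite roof_sumD.
have : T a (k + s * n%:Z) = T a k + T (shift k a) (s * n%:Z) by rewrite roof_sumD.
rewrite [k + _]addrC => -> -> e1 e2.
have := ler_normB (h1 - r1 + (T c k + T (shift k c) (s * n%:Z)) - (T a k + T (shift k a) (s * n%:Z)))
  (h2 - r2 + T (shift k c) (s * n%:Z) - T (shift k a) (s * n%:Z)).
move=> /le_trans/(_ (lerD e2 e1)).
rewrite -splitr; congr (`|_| <= _); ring.
Qed.

Lemma roof_sum_ge_roof a k : 2 <= k -> tau a + m <= T a k.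
Proof.
move=> k2; rewrite -[k](subrKC 1) roof_sumD roof_sum1 lerD2l.
apply: le_trans (roof_sum_ge tau_ge _ _); last by lia.
by rewrite ler_peMr ?ler1z ?(ltW m_gt0)//; lia.
Qed.

(** The index starts at -1 because [r] may overshoot its column by less than [m]; the bound on [t]
    drives the index to infinity with time. *)
Lemma signed_cell s c r t : absz s = 1%N -> - m < r < tau c + m -> 0 <= t ->
  exists k, [/\ -1 <= k, 0 <= r + s%:~R * t - T c (s * k) <= tau (shift (s * k) c) &
    t <= M * (k + 1)%:~R + `|r|].
Proof.
move=> s1 /andP[r0 r1] t0.
have [j hj] := orbit_point_canonical m_gt0 tau_ge c (r + s%:~R * t).
have rr := ler_norm r; have rr' := ler_norm (- r); rewrite normrN in rr'.
have lo : T c j <= r + s%:~R * t by lra.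
have hi : r + s%:~R * t <= T c (j + 1) by rewrite roof_sumS; lra.
have up := roof_sum_upper tau_le c.
have [sE|sE] : s = 1 \/ s = -1 by clear -s1; lia.
  rewrite sE; rewrite sE (_ : 1%:~R = 1 :> R)// mul1r in hj lo hi *.
  have j1 : -1 <= j.
    rewrite leNgt; apply/negP => j1.
    have := roof_sum_le tau_ge c (n := j + 1) ltac:(clear -j1; lia).
    have : m * (j + 1)%:~R <= m * (-1)%:~R by rewrite ler_pM2l// ler_int; clear -j1; lia.
    by rewrite (_ : (-1)%:~R = -1 :> R)// mulrN1; lra.
  exists j; rewrite mul1r; split=> //.
  have := up (j + 1); rewrite ifT; last by clear -j1; lia.
  by lra.
rewrite sE; rewrite sE (_ : (-1)%:~R = -1 :> R)// mulN1r in hj lo hi *.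
have j1 : j <= 1.
  rewrite leNgt; apply/negP => j1; have := roof_sum_ge_roof c (k := j) ltac:(clear -j1; lia).
  by lra.
exists (- j); rewrite mulN1r opprK; split=> //; first by clear -j1; lia.
have [j0|j0] := leP j 0; last first.
  have j_eq : j = 1 by clear -j0 j1; lia.
  rewrite j_eq roof_sum1 in lo; rewrite j_eq addNr mulr0 add0r.
  by have := tau_gt0 c; lra.
have Mj : M * j%:~R <= T c j.
  have := up j; case: ifP => // j0' _; have -> : j = 0 by clear -j0 j0'; lia.
  by rewrite mulr0 roof_sum0.
by rewrite rmorphD rmorphN /= (_ : 1%:~R = 1 :> R)//; move: M_gt0; lra.
Qed.

(** The Hölder property in the form used for existence; [asymptotic_offset] supplies it with [rate]
    as [q]. *)
Variable q : R.
Hypothesis q_bounds : 0 < q < 1.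
Hypothesis tau_offset : forall e : R, 0 < e -> exists2 eta : R, 0 < eta &
  forall (s : int) (a c : Sigma), absz s = 1%N ->
  (forall i : int, 0 <= s * i -> a i = c i) -> dist a c <= eta ->
  exists l, forall n : nat,
  `|l + T c (s * n%:Z) - T a (s * n%:Z)| <= e * q ^+ n.

(** Counterpart of [asymptotic_shadow]: in the cell of index [k] the base distance and the offset
    are both geometrically small in [k], and [rho_small] converts this to [rho]. *)
Lemma asymptotic_of_offset e : 0 < e -> exists2 eta : R, 0 < eta & forall s c r a h,
  absz s = 1%N -> (forall i : int, 0 <= s * i -> c i = a i) -> dist c a <= eta ->
  - eta <= r <= tau c + eta ->
  (forall n : nat, `|height_offset c r a h (s * n%:Z)| <= eta * q ^+ n) ->
  asymptotic s e (pt a h) (pt c r).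
Proof.
move=> e0; have [eta1 eta10 close] := rho_small e0.
have [eta2 eta20 step] := offset_step (e := eta1 / 2) ltac:(by rewrite divr_gt0).
have [eta eta0 [e1 e2 em _]] := @ex_pos_le4 R (eta1 / 2) eta2 (m / 2) 1
  ltac:(by rewrite divr_gt0) eta20 ltac:(by rewrite divr_gt0) ltr01.
exists eta => // s c r a h s1 agree ca /andP[rlo rhi] off.
have /andP[q0 q1] := q_bounds.
have rc : - m < r < tau c + m by move: m_gt0; lra.
have rhoE t k : rho (flow (s%:~R * t) (pt c r)) (flow (s%:~R * t) (pt a h)) =
    rho (pt (shift (s * k) c) (r + s%:~R * t - T c (s * k)))
        (pt (shift (s * k) a) (h + s%:~R * t - T a (s * k))).
  by rewrite !flow_point -!orbit_point_shift !subrK.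
have heightE t k : h + s%:~R * t - T a (s * k) - (r + s%:~R * t - T c (s * k))
    = height_offset c r a h (s * k) by rewrite /height_offset; ring.
have nonneg (n : nat) : `|height_offset c r a h (s * n%:Z)| <= eta * q ^+ n /\
    dist (shift (s * n%:Z) c) (shift (s * n%:Z) a) <= eta * (1 / 2) ^+ n.
  split=> //; apply: le_trans (dist_shift_contractX R n s1 agree) _.
  by rewrite mul1r exprVn ler_wpM2r// invr_ge0 exprn_ge0.
split=> [e' e'0|t t0].
  have [eta' eta'0 close'] := rho_small e'0.
  have ee0 : 0 < eta' / eta by rewrite divr_gt0.
  have [N1 hN1] := ex_expr_le q_bounds ee0.
  have [N2 hN2] := @ex_expr_le R (1 / 2) _ ltac:(by lra) ee0.
  (* By the time bound of [signed_cell], this forces the cell index past [N1 + N2]. *)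
  exists (M * (N1 + N2)%:R + `|r| + M + 1) => t ht.
  have t0 : 0 <= t.
    by apply: le_trans ht; rewrite !addr_ge0// ?mulr_ge0// ltW.
  have [k [_ cell tk]] := signed_cell s1 rc t0.
  have kN : (N1 + N2)%:Z <= k.
    have : M * (N1 + N2)%:R < M * (k%:~R) by move: tk; rewrite rmorphD /=; lra.
    by rewrite ltr_pM2l// pmulrn ltr_int => /ltW.
  have [n kn] : exists n : nat, k = n%:Z by exists (absz k); rewrite gez0_abs//; apply: le_trans kN.
  rewrite kn in cell kN; rewrite (rhoE t n%:Z); have [h1 h2] := nonneg n.
  apply: close' => //.
    apply: le_trans h2 _; rewrite mulrC -ler_pdivlMr// hN2//.
    by move: kN; clear; lia.
  rewrite heightE; apply: le_trans h1 _; rewrite mulrC -ler_pdivlMr// hN1//.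
  by move: kN; clear; lia.
have [k [k1 cell _]] := signed_cell s1 rc t0.
rewrite (rhoE t k).
suff [h1 h2] : `|height_offset c r a h (s * k)| <= eta1 /\ dist (shift (s * k) c) (shift (s * k) a) <= eta1.
  by apply: close; rewrite ?heightE.
have [k0|k0] := leP 0 k.
  have -> : k = (absz k)%:Z by rewrite gez0_abs.
  have [h1 h2] := nonneg (absz k); split.
    apply: le_trans h1 _; have : q ^+ absz k <= 1 by rewrite exprn_ile1// ltW.
    by move=> qk; rewrite (le_trans (ler_piMr (ltW eta0) qk))//; lra.
  apply: le_trans h2 _; have qk : (1 / 2 : R) ^+ absz k <= 1 by rewrite exprn_ile1//; lra.
  by rewrite (le_trans (ler_piMr (ltW eta0) qk))//; lra.
(* The cell before the starting one: a single step against [s] from index 0 controls it. *)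
have -> : s * k = - s by have -> : k = -1 by [clear -k0 k1; lia]; rewrite mulrN1.
have s1' : absz (- s) = 1%N by rewrite abszN.
split; last by have := dist_shift1 R c a s1'; lra.
have := step (- s) c r a h 0 s1'; rewrite !shift0 addr0 => /(_ (le_trans ca e2)).
have := nonneg 0%N; rewrite mulr0 expr0 mulr1 => -[h0 _] h1.
have := ler_normD (height_offset c r a h (- s) - height_offset c r a h 0) (height_offset c r a h 0).
by rewrite subrK; lra.
Qed.

(** * Uniqueness and existence of the product point *)

Lemma roof_sum_le_roof b k : T b k <= tau b + m / 2 -> k <= 1.
Proof.
move=> h; rewrite leNgt; apply/negP => k1.
by have := @roof_sum_ge_roof b k ltac:(clear -k1; lia); move: m_gt0; lra.
Qed.

(** Shadowing in both directions determines the bases of [z1] and [z2] up to one common shift; the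
    vanishing offsets then determine the height from [y] and the time from [x]. *)
Lemma local_product_unique : exists2 eta : R, 0 < eta & forall x y t1 t2 z1 z2,
  `|t1| <= eta -> `|t2| <= eta ->
  asymptotic 1 eta (flow t1 x) z1 -> asymptotic (-1) eta y z1 ->
  asymptotic 1 eta (flow t2 x) z2 -> asymptotic (-1) eta y z2 ->
  t1 = t2 /\ z1 = z2.
Proof.
have m8 : 0 < m / 8 by rewrite divr_gt0.
have m32 : 0 < m / 32 by rewrite divr_gt0.
have [eta1 eta10 step] := roof_sum_step_near m8.
have [eta2 eta20 tau_near] := tau_uc m8.
have [e e0 [ee1 ee2 em _]] := @ex_pos_le4 R (eta1 / 2) eta2 (m / 32) 1
  ltac:(by rewrite divr_gt0) eta20 m32 ltr01.
have [eta3 eta30 shadow] := asymptotic_shadow e0.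
have [eta eta0 [eta_3 eta_m _ _]] := @ex_pos_le4 R eta3 (m / 32) 1 1 eta30 m32 ltr01 ltr01.
have shadow' s c r x : absz s = 1%N -> 0 <= r <= tau c -> asymptotic s eta x (pt c r) ->
  exists a h, [/\ x = pt a h, `|h - r| <= e, dist c a <= e,
    forall i : int, 0 <= s * i -> c i = a i &
    forall e', 0 < e' -> exists N : nat, forall n : nat, (N <= n)%N ->
      `|height_offset c r a h (s * n%:Z)| <= e'].
  move=> s1 hr [lim bound]; apply: shadow => //; split=> // t t0.
  exact: le_trans (bound t t0) eta_3.
exists eta => // x y t1 t2 z1 z2 ht1 ht2.
have [c1 [r1 [hr1 ->]]] := orbit_point_surj m_gt0 tau_ge z1.
have [c2 [r2 [hr2 ->]]] := orbit_point_surj m_gt0 tau_ge z2.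
have [a0 [h0 [_ ->]]] := orbit_point_surj m_gt0 tau_ge x.
rewrite !flow_point => st1 un1 st2 un2.
have [a1 [h1 [/orbit_point_eq[p1 [a1E h1E]] hr1' ca1 agr1 lim1]]] := shadow' 1 _ _ _ erefl hr1 st1.
have [b1 [k1 [y1 kr1 cb1 agrb1 limb1]]] := shadow' (-1) _ _ _ erefl hr1 un1.
have [a2 [h2 [/orbit_point_eq[p2 [a2E h2E]] hr2' ca2 agr2 lim2]]] := shadow' 1 _ _ _ erefl hr2 st2.
have [b2 [k2 [y2 kr2 cb2 agrb2 limb2]]] := shadow' (-1) _ _ _ erefl hr2 un2.
(* Near a roof the two representations of [y], and those of [x], may be shifted
   by [n] in {-1, 0, 1}; the same [n] serves for both. *)
have [n [b2E k1E]] : exists k, b2 = shift k b1 /\ k1 = k2 + T b1 k.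
  by apply: (@orbit_point_eq _ _ _ m_gt0 tau_ge); rewrite -y1.
have [p [a2E' h12E]] : exists k, a2 = shift k a1 /\ h1 - t1 = h2 - t2 + T a1 k.
  exists (p2 - p1); rewrite a1E shiftD subrK -a2E; split=> //.
  by have := roof_sumD tau a0 p1 (p2 - p1); rewrite subrKC; lra.
move: hr1' hr2' kr1 kr2 ht1 ht2; rewrite !ler_norml => /andP[? ?] /andP[? ?] /andP[? ?] /andP[? ?] /andP[? ?] /andP[? ?].
move: hr1 hr2 => /andP[? ?] /andP[? ?].
have tau_b c b : dist c b <= e -> tau c <= tau b + m / 8.
  move=> cb; have := tau_near c b (le_trans cb ee2); have := ler_norm (tau c - tau b); lra.
have tb1 := tau_b _ _ cb1; have tb2 := tau_b _ _ cb2.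
have n1 : n <= 1 by apply: (@roof_sum_le_roof b1); lra.
have n2 : - n <= 1.
  apply: (@roof_sum_le_roof b2); rewrite b2E roof_sumN -b2E; lra.
have absn : (absz n <= 1)%N by clear -n1 n2; lia.
have near_n : `|T b1 n - T a1 n| <= m / 8.
  have [->|n0] := eqVneq n 0; first by rewrite !roof_sum0 subrr normr0 ltW.
  have := @step n 0 a1 b1 ltac:(clear -n0 absn; lia).
  rewrite !shift0 addr0 !roof_sum0 !subr0; apply.
  have := dist_triangle R c1 b1 a1; rewrite (dist_sym R b1 c1); lra.
(* All heights being close, the roof sums of [a1] at [n] and [p] differ by less than [m]. *)
have np : n = p.
  apply/eqP; apply: contraT => /(roof_sum_sep m_gt0 tau_ge a1).
  move: near_n; rewrite ler_norml => /andP[? ?].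
  have : `|T a1 n - T a1 p| < m by rewrite ltr_norml; apply/andP; split; lra.
  by rewrite ltNge => /negP.
rewrite -np in a2E' h12E; clear tau_b tb1 tb2 near_n np p.
have c2E : c2 = shift n c1.
  apply/funext => i; have [i0|i0] := leP 0 i.
    rewrite agr2 ?mul1r// a2E' /shift; have [j0|j0] := leP 0 (i + n).
      by rewrite agr1 ?mul1r.
    (* The one index where the two splittings disagree. Both agreements include index 0, so the
       value can be read from the past. *)
    have -> : i = 0 by clear -i0 j0 absn; lia.
    have := agrb2 0 isT; rewrite agr2// a2E' b2E /shift add0r => ->.
    by rewrite agrb1// mulN1r oppr_ge0; clear -i0 j0 absn; lia.
  rewrite agrb2; last by rewrite mulN1r oppr_ge0 ltW.
  rewrite b2E /shift agrb1// mulN1r oppr_ge0; clear -i0 absn; lia.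
rewrite c2E a2E' in lim2; rewrite c2E b2E in limb2.
(* The past fixes the height of the product point, the future then the flow time. *)
have r12 := offset_lim_unique (s := -1) erefl limb1 limb2.
have h12 := offset_lim_unique (s := 1) erefl lim1 lim2.
have r12' : r1 = r2 + T c1 n by lra.
split; first by lra.
by rewrite c2E -orbit_point_shift -r12'.
Qed.

Lemma local_product_exists e : 0 < e -> exists2 delta : R, 0 < delta & forall x y,
  rho x y <= delta -> exists t z,
  [/\ `|t| <= e, asymptotic 1 e (flow t x) z & asymptotic (-1) e y z].
Proof.
move=> e0; have [eta eta0 asym] := asymptotic_of_offset e0.
(* Thirds, since the time is a sum of [ls], [- lu] and [k - r0], and the height bound loses three
   such errors as well. *)
have [e1 e10 [e1_eta e1_e _ _]] := @ex_pos_le4 R (eta / 3) (e / 3) 1 1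
  ltac:(by rewrite divr_gt0) ltac:(by rewrite divr_gt0) ltr01 ltr01.
have [eta1 eta10 off] := tau_offset e10.
have [eta2 eta20 tau_near] := tau_uc e10.
have [e2 e20 [e2_1 e2_2 e2_e1 e2_4]] := @ex_pos_le4 R eta1 eta2 e1 (1 / 4) eta10 eta20 e10 ltac:(by lra).
have [delta delta0 near] := near_of_rho_small e20.
exists delta => // x y; have [a [r0 [hr0 ->]]] := orbit_point_surj m_gt0 tau_ge x.
move=> /(near _ _ _ hr0)[b [k [-> ab kr0]]].
pose c : Sigma := fun i => if 0 <= i then a i else b i.
have ca i : 0 <= 1 * i -> a i = c i by rewrite mul1r /c => ->.
have cb i : 0 <= -1 * i -> b i = c i.
  rewrite mulN1r oppr_ge0 /c le_eqVlt => /orP[/eqP ->|]; last by rewrite ltNge => /negbTE ->.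
  (* At index 0 the sequence [c] takes its symbol from [a], which there equals that of [b]. *)
  by rewrite lexx; apply/esym/(@dist_lt_third R); lra.
have cab i : c i = a i \/ c i = b i by rewrite /c; case: ifP; [left|right].
have dac : dist a c <= e2 by apply: le_trans (dist_bracket R cab) ab.
have dbc : dist b c <= e2.
  by apply: le_trans ab; rewrite (dist_sym R a b); apply: dist_bracket => i; case: (cab i); [right|left].
have [ls hls] := off 1 a c erefl ca (le_trans dac e2_1).
have [lu hlu] := off (-1) b c erefl cb (le_trans dbc e2_1).
have ls0 : `|ls| <= e1 by have := hls 0%N; rewrite mulr0 !roof_sum0 subr0 addr0 expr0 mulr1.
have lu0 : `|lu| <= e1 by have := hlu 0%N; rewrite mulr0 !roof_sum0 subr0 addr0 expr0 mulr1.
have tac := tau_near a c (le_trans dac e2_2); have tac' := ler_norm (tau a - tau c).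
have qn (n : nat) : 0 <= q ^+ n by have /andP[q0 _] := q_bounds; rewrite exprn_ge0// ltW.
have weaken (n : nat) (u : R) : `|u| <= e1 * q ^+ n -> `|u| <= eta * q ^+ n.
  by move=> /le_trans -> //; rewrite ler_wpM2r//; lra.
move: ls0 lu0 kr0 hr0; rewrite !ler_norml => /andP[? ?] /andP[? ?] /andP[? ?] /andP[? ?].
(* The height makes the offset from [y] at index 0 equal to [lu]; the time makes the offset from the
   flowed [x] equal to [ls]. *)
exists (k - lu + ls - r0), (pt c (k - lu)); split.
- by rewrite ler_norml; apply/andP; split; lra.
- rewrite flow_point; apply: asym => //.
  + by move=> i /ca ->.
  + by rewrite dist_sym; lra.
  + by apply/andP; split; lra.
  + move=> n; apply: weaken; have := hls n; congr (`|_| <= _); rewrite /height_offset; ring.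
- apply: asym => //.
  + by move=> i /cb ->.
  + by rewrite dist_sym; lra.
  + by apply/andP; split; lra.
  + move=> n; apply: weaken; have := hlu n; congr (`|_| <= _); rewrite /height_offset; ring.
Qed.

(** * Return to the stable and unstable sets *)

Lemma rho_ge0 x y : 0 <= rho x y.
Proof.
by apply: lb_le_inf; [exact: rho0_set_neq0|move=> _ [s [chain _ ->]]; exact: chain_length_ge0].
Qed.

Lemma stable_setE e x z : stable_set (@rho R tau) (@flow R tau) e x z <-> asymptotic 1 e x z.
Proof.
split=> -[lim bound]; split.
- move=> e' e'0; have /cvgrPdist_le/(_ e' e'0)[B [_ hB]] := lim.
  (* Neighbourhoods of infinity are strict rays, hence the added 1. *)
  exists (B + 1) => t Bt; rewrite mul1r.
  have := hB t ltac:(lra); rewrite sub0r normrN; exact: le_trans (ler_norm _).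
- by move=> t t0; rewrite mul1r; exact: bound.
- apply/cvgrPdist_le => e' e'0; have [B hB] := lim e' e'0.
  exists B; split; first exact: num_real.
  move=> t Bt; rewrite sub0r normrN ger0_norm ?rho_ge0//.
  by have := hB t (ltW Bt); rewrite mul1r.
- by move=> t t0; have := bound t t0; rewrite mul1r.
Qed.

Lemma unstable_setE e x z : unstable_set (@rho R tau) (@flow R tau) e x z <-> asymptotic (-1) e x z.
Proof.
have N1 : (-1)%:~R = -1 :> R by [].
split=> -[lim bound]; split.
- move=> e' e'0; have /cvgrPdist_le/(_ e' e'0)[B [_ hB]] := lim.
  exists (1 - B) => t Bt; rewrite N1 mulN1r.
  have := hB (- t) ltac:(lra); rewrite sub0r normrN; exact: le_trans (ler_norm _).
- by move=> t t0; rewrite N1 mulN1r; apply: bound; rewrite oppr_le0.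
- apply/cvgrPdist_le => e' e'0; have [B hB] := lim e' e'0.
  exists (- B); split; first exact: num_real.
  move=> t Bt; rewrite sub0r normrN ger0_norm ?rho_ge0//.
  by have := hB (- t) ltac:(lra); rewrite N1 mulN1r opprK.
- by move=> t t0; have := bound (- t) ltac:(lra); rewrite N1 mulN1r opprK.
Qed.

(** The scale of uniqueness serves as [eps0]: at a smaller scale the sets only shrink, so uniqueness
    persists. *)
Lemma suspension_local_product_structure :
  local_product_structure (@rho R tau) (@flow R tau).
Proof.
have [eta eta0 uniq] := local_product_unique.
exists eta => // e /andP[e0 e_eta]; have [delta delta0 ex] := local_product_exists e0.
have mono s x z : asymptotic s e x z -> asymptotic s eta x z.
  by move=> [lim bound]; split=> // t t0; exact: le_trans (bound t t0) e_eta.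
exists delta => // x y /ex[t [z [te st un]]].
have zin : (stable_set (@rho R tau) (@flow R tau) e (flow t x) `&`
    unstable_set (@rho R tau) (@flow R tau) e y) z.
  by split; [exact/stable_setE|exact/unstable_setE].
have all_eq t' z' : `|t'| <= e -> (stable_set (@rho R tau) (@flow R tau) e (flow t' x) `&`
    unstable_set (@rho R tau) (@flow R tau) e y) z' -> t = t' /\ z = z'.
  move=> t'e [/stable_setE st' /unstable_setE un'].
  exact: (uniq x y t t' z z' (le_trans te e_eta) (le_trans t'e e_eta)
    (mono _ _ _ st) (mono _ _ _ un) (mono _ _ _ st') (mono _ _ _ un')).
exists t; split=> [|t' [t'e [z' [z'in _]]]]; last by have [] := all_eq t' z' t'e z'in.
by split=> //; exists z; split=> // z' /(all_eq t z' te)[].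
Qed.

End Dynamics.

Theorem theorem1p2 (R : realType) (tau1 : (int -> bool) -> R)
  (tau1_gt0 : forall a : int -> bool, 0 < tau1 a)
  (L alpha : R) (L_ge1 : 1 <= L) (alpha_gt0 : 0 < alpha) (alpha_le1 : alpha <= 1)
  (tau1_holder : forall a b : int -> bool,
     `|tau1 a - tau1 b| <= L * powR (dist R a b) alpha) :
  local_product_structure (@rho R tau1) (@flow R tau1).
Proof.
have uc := holder_uniformly_continuous L_ge1 alpha_gt0 tau1_holder.
have [m m_gt0 tau1_ge] := uniformly_continuous_pos_lower_bound tau1_gt0 uc.
exact: (suspension_local_product_structure m_gt0 tau1_ge
  (holder_upper_bound L_ge1 alpha_gt0 tau1_holder) uc (rate_bounds alpha_gt0)
  (asymptotic_offset L_ge1 alpha_gt0 tau1_holder)).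
Qed.
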